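(* Let $(X,d)$ be a proper metric space with basepoint $x_0\in X$, and let $Z_n$ be an integrable ergodic cocycle taking values in $\mathrm{Isom}(X)$. That is, let $(\Omega,\mu)$ be a standard Borel space with $\mu(\Omega)=1$, $L:\Omega\to\Omega$ an ergodic measure-preserving transformation, $g:\Omega\to\mathrm{Isom}(X)$ a measurable map with $\int_\Omega d(g(\omega)x_0,x_0)\,d\mu(\omega)<\infty$, and $Z_n(\omega)=g(\omega)g(L\omega)\cdots g(L^{n-1}\omega)$. Let $A$ be the constant such that $A=\lim_{n\to\infty}\frac1n d(Z_n(\omega)x_0,x_0)$ for $\mu$-almost every $\omega$. Then for $\mu$-almost every $\omega$ there is a horofunction $h=h_\omega$, depending measurably on $\omega$, such that $$\lim_{n\to\infty}-\frac1n\,h_\omega\big(Z_n(\omega)x_0\big)=A .$$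
   Context: A metric space is proper if its closed bounded subsets are compact. $\mathrm{Isom}(X)$ is the isometry group of $X$, with the topology of uniform convergence on compact sets and its Borel $\sigma$-algebra. The constant $A$ exists, and is the same for almost every $\omega$, by Kingman's subadditive ergodic theorem and ergodicity. Horofunctions: let $C(X)$ be the space of continuous functions $X\to\mathbf{R}$ with the topology of uniform convergence on compact sets, and let $\Phi:X\to C(X)$, $\Phi(x)=d(x,\cdot)-d(x,x_0)$. The closure $H=\overline{\Phi(X)}$ is a compact metrizable space. A horofunction (based at $x_0$) is a function $h:X\to\mathbf{R}$ of the form $h(z)=\lim_{n\to\infty}\big(d(x_n,z)-d(x_n,x_0)\big)$, the convergence being uniform on compact sets, for some sequence of points $x_n\to\infty$ in $X$; the horofunctions are the elements of $H\setminus\Phi(X)$. ''Depending measurably on $\omega$'' means that $\omega\mapsto h_\omega$ is an almost everywhere defined measurable map from $\Omega$ to $H$.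
   Formalization: The space X is additionally assumed to be noncompact: if X is compact, no sequence of points tends to infinity, so there are no horofunctions at all and the claim as stated fails. *)

(* Defs.v *)
From HB Require Import structures.
From mathcomp Require Import all_boot all_order all_algebra.
From mathcomp Require Import all_classical all_reals all_analysis.

Set Implicit Arguments.
Unset Strict Implicit.
Unset Printing Implicit Defensive.

Import Order.TTheory GRing.Theory Num.Theory.
Import numFieldTopology.Exports numFieldNormedType.Exports.

Local Open Scope classical_set_scope.
Local Open Scope ring_scope.

Definition borel (T : ptopologicalType) : Type := g_sigma_algebraType (@open T).
HB.instance Definition _ (T : ptopologicalType) := Measurable.on (borel T).

Definition separable_space (X : topologicalType) :=
  exists2 D : set X, countable D & dense D.

Definition complete_space (X : uniformType) :=
  forall F : set_system X, ProperFilter F -> cauchy F -> exists x : X, F --> x.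

Definition metric_bounded (R : realType) (X : metricType R) (B : set X) :=
  exists r : R, forall x y, B x -> B y -> mdist x y <= r.

Definition proper_space (R : realType) (X : metricType R) :=
  forall B : set X, closed B -> metric_bounded B -> compact B.

(* The sigma-algebra is the Borel sigma-algebra of a Polish topology, which is
   transported along a bijection from a complete separable metric space. *)
Definition standard_borel (R : realType) d (T : measurableType d) :=
  exists (S : metricType R) (f : T -> S),
    [/\ complete_space S, separable_space S, bijective f &
        forall B : set T, measurable B <-> <<s @open S >> (f @` B)].

Section isometry_group.
Context {R : realType} (X : metricType R).

(* Surjectivity is recorded by a two-sided inverse. *)
Record isom := Isom {
  isom_fun :> X -> X ;
  isom_inv : X -> X ;
  isom_dist : forall x y, mdist (isom_fun x) (isom_fun y) = mdist x y ;
  isom_funK : cancel isom_fun isom_inv ;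
  isom_invK : cancel isom_inv isom_fun }.

Lemma isomP (f g : isom) : f =1 g -> f = g.
Proof.
case: f g => [f f' fd fK f'K] [g g' gd gK g'K] /= /funext fg.
subst g; have f'g' : f' = g'.
  by apply/funext => x; apply: (can_inj fK); rewrite f'K g'K.
by subst g'; congr Isom; exact: Prop_irrelevance.
Qed.

Definition isom1 : isom :=
  @Isom idfun idfun (fun _ _ => erefl) (fun _ => erefl) (fun _ => erefl).

Lemma isomM_dist (f g : isom) x y : mdist (f (g x)) (f (g y)) = mdist x y.
Proof. by rewrite !isom_dist. Qed.

Definition isomM (f g : isom) : isom :=
  @Isom (f \o g) (isom_inv g \o isom_inv f) (isomM_dist f g)
    (can_comp (@isom_funK f) (@isom_funK g))
    (can_comp (@isom_invK g) (@isom_invK f)).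

Lemma isomV_dist (f : isom) x y :
  mdist (isom_inv f x) (isom_inv f y) = mdist x y.
Proof. by rewrite -(isom_dist f) !isom_invK. Qed.

Definition isomV (f : isom) : isom :=
  @Isom (isom_inv f) f (@isomV_dist f) (@isom_invK f) (@isom_funK f).

HB.instance Definition _ := gen_eqMixin isom.
HB.instance Definition _ := gen_choiceMixin isom.
HB.instance Definition _ := isPointed.Build isom isom1.

Lemma isomA : associative isomM. Proof. by move=> f g h; exact: isomP. Qed.
Lemma isom1M : left_id isom1 isomM. Proof. by move=> f; exact: isomP. Qed.
Lemma isomM1 : right_id isom1 isomM. Proof. by move=> f; exact: isomP. Qed.
Lemma isomVM : left_inverse isom1 isomV isomM.
Proof. by move=> f; apply: isomP => x /=; exact: isom_funK. Qed.
Lemma isomMV : right_inverse isom1 isomV isomM.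
Proof. by move=> f; apply: isomP => x /=; exact: isom_invK. Qed.

HB.instance Definition _ :=
  isGroup.Build isom isomA isom1M isomM1 isomVM isomMV.

HB.instance Definition _ := Topological.copy isom
  (initial_topology (isom_fun : isom -> {family compact, X -> X})).

End isometry_group.

Section ergodicity.
Context d (T : measurableType d) (R : realType) (mu : probability T R).

Definition measure_preserving (L : T -> T) :=
  measurable_fun setT L /\
  forall B, measurable B -> mu (L @^-1` B) = mu B.

Definition ergodic (L : T -> T) :=
  forall B, measurable B -> L @^-1` B = B -> mu B = 0%E \/ mu B = 1%E.

End ergodicity.

(* The product is composition in [isom X]:
   [cocycle L g n w = g w \o g (L w) \o ... \o g (L^(n-1) w)]. *)
Definition cocycle {R : realType} {X : metricType R} {T : Type} (L : T -> T)
    (g : T -> isom X) (n : nat) (w : T) : isom X :=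
  (\prod_(0 <= i < n) g (iter i L w))%g.

(* Continuous real functions with the topology of uniform convergence on
   compact sets. *)
Definition cfun {R : realType} (X : metricType R) : Type := initial_topology
  (fun f : continuousType X R => (f : X -> R) : {family compact, X -> R}).
HB.instance Definition _ {R : realType} (X : metricType R) :=
  Topological.on (cfun X).

Definition cfun_fun {R : realType} {X : metricType R} (f : cfun X) : X -> R :=
  (f : continuousType X R).

Section horofunctions.
Context {R : realType} {X : metricType R} (x0 : X).

Definition ndist (x z : X) : R := mdist x z - mdist x x0.

Lemma ndist_continuous x : continuous (ndist x).
Proof.
move=> z; apply/cvgrPdist_le => e e0; near=> t.
have /ltW zt : mdist z t < e.
  by near: t; have := nbhsx_ballx z e e0; rewrite ballEmdist.
have tz : mdist t z <= e by rewrite metric_sym.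
rewrite /ndist opprB addrA subrK ler_norml lerBrDr lerBlDr addrC.
apply/andP; split.
- by rewrite lerBlDr (le_trans (metric_triangle x z t))// lerD2l.
- by rewrite (le_trans (metric_triangle x t z))// addrC lerD2r.
Unshelve. all: by end_near. Qed.

Definition Phi (x : X) : cfun X := mkcts (ndist_continuous (x := x)).

Definition Phi_closure : set (cfun X) := closure (range Phi).

Lemma Phi_in_closure : Phi x0 \in Phi_closure.
Proof. by apply/mem_set/subset_closure; exists x0. Qed.

(* The space H, with the subspace topology. *)
Definition hspace : Type := set_type Phi_closure.
HB.instance Definition _ := Topological.on hspace.
HB.instance Definition _ :=
  isPointed.Build hspace (exist _ (Phi x0) Phi_in_closure).

Definition hspace_fun (h : hspace) : X -> R := cfun_fun (set_val h).

Definition to_infinity (x : nat -> X) :=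
  forall K : set X, compact K -> \forall n \near \oo, ~ K (x n).

(* When X is geodesic, these are exactly the elements of H outside the range of
   Phi. In general an element of H outside that range is a horofunction, and a
   horofunction which is not bounded below is outside that range. *)
Definition horofunction (h : X -> R) :=
  exists x : nat -> X,
    to_infinity x /\ {family compact, (fun n => ndist (x n)) @ \oo --> h}.

End horofunctions.

(* Main.v *)
(* Write [a n w] for the distance from [Z_n(w) x0] to [x0]. Call [n] good for [w]
   when [a n w - a (n - l) (L^l w) >= (A - eps_l) l] for all [l <= n], with
   [eps_l -> 0]. The left hand side is [- ndist x0 (Z_n x0) (Z_l x0)], so every
   limit [h] of the functions [ndist x0 (Z_n x0)] along good times satisfies
   [- h (Z_l x0) >= (A - eps_l) l], while [- h (Z_l x0) <= a l w] always holds.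
   That almost every [w] has infinitely many good times is a quantitative form
   of an argument of Karlsson and Margulis, due to Gouezel and Karlsson: if bad
   times had positive density, a greedy covering of [1..N] by the intervals
   (n - l, n] attached to bad times would make [a N] smaller than [(A - eps) N]
   on average. The limit is made measurable in [w] by a diagonal extraction which
   keeps, at each step, the least of finitely many labels occurring infinitely
   often. When [A = 0] any horofunction will do. *)

Require Import Defs.
From HB Require Import structures.
From mathcomp Require Import all_boot all_order all_algebra.
From mathcomp Require Import all_classical all_reals all_analysis.
From mathcomp Require Import measurable_realfun ring lra zify.

Set Implicit Arguments.
Unset Strict Implicit.
Unset Printing Implicit Defensive.

Import Order.TTheory GRing.Theory Num.Theory.
Import numFieldTopology.Exports numFieldNormedType.Exports.

Local Open Scope classical_set_scope.
Local Open Scope ring_scope.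

(** * Greedy covering *)

Lemma le_partial_sum {R : numDomainType} (u : nat -> R) n k :
  (forall i, 0 <= u i) -> (k <= n)%N -> \sum_(i < k) u i <= \sum_(i < n) u i.
Proof.
move=> u0 /subnK <-; elim: (n - k)%N => [|l IH]; first by rewrite add0n.
by rewrite addSn big_ord_recr /= (le_trans IH)// lerDl.
Qed.

Section greedy_covering.
Context {R : realType}.
(** The sequence [c] can climb in three ways: a unit step costs [M] plus an error [e], a block of
    length [m] between multiples of [m] costs [A] per unit of length plus an error [r], and a jump
    ending at a bad time saves [eps] per unit of length. *)
Variables (A eps M : R) (c e r : nat -> R) (bad : pred nat) (m K N : nat).
Hypotheses (m0 : (0 < m)%N) (K0 : (0 < K)%N).
Hypotheses (A0 : 0 <= A) (eps0 : 0 <= eps) (M0 : 0 <= M).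
Hypotheses (e0 : forall n, 0 <= e n) (r0 : forall n, 0 <= r n) (c0 : c 0%N = 0).
Hypothesis c_step : forall n, (n < N)%N -> c n.+1 <= c n + M + e n.
Hypothesis c_block : forall j, (j.+1 * m <= N)%N ->
  c (j.+1 * m)%N <= c (j * m)%N + A * m%:R + r j.
Hypothesis c_bad : forall n, (n <= N)%N -> bad n ->
  exists l, [/\ (K <= l)%N, (l <= n)%N & c n <= c (n - l)%N + (A - eps) * l%:R].

Let B n := (\sum_(i < n) bad i.+1)%N.
Let E n := \sum_(i < n) e i.
Let S n := \sum_(j < n %/ m) r j.

Let B_add n l : (B (n + l) <= B n + l)%N.
Proof.
elim: l => [|l IH]; first by rewrite !addn0.
rewrite addnS {1}/B big_ord_recr /= -/(B _).
by have := leq_b1 (bad (n + l).+1); lia.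
Qed.

Let B_nobad n k : (forall i, (n < i <= n + k)%N -> ~~ bad i) -> B (n + k) = B n.
Proof.
elim: k => [|k IH] nb; first by rewrite addn0.
rewrite addnS {1}/B big_ord_recr /= -/(B _) IH; last first.
  by move=> i /andP[ni ik]; apply: nb; rewrite ni addnS (leq_trans ik).
by rewrite (negbTE (nb _ _)) ?addn0// addnS ltnS leq_addr /=.
Qed.

Let c_steps n k : (n + k <= N)%N -> c (n + k)%N <= c n + M * k%:R + (E (n + k) - E n).
Proof.
elim: k => [|k IH] nkN; first by rewrite addn0; lra.
rewrite addnS in nkN *; have := c_step nkN; have := IH (ltnW nkN).
by rewrite {3}/E big_ord_recr /= -/(E _) -natr1; lra.
Qed.

Let last_bad n : (forall i, (0 < i <= n)%N -> ~~ bad i) \/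
  exists k l, [/\ n = (k + l)%N, bad k & forall i, (k < i <= k + l)%N -> ~~ bad i].
Proof.
elim: n => [|n IH]; first by left => i; lia.
have [bn|bn] := boolP (bad n.+1).
  by right; exists n.+1, 0%N; split => //; [rewrite addn0|move=> i; lia].
case: IH => [nb|[k [l [nE bk nb]]]].
  by left => i i0; have [->//|in1] := eqVneq i n.+1; apply: nb; lia.
right; exists k, l.+1; rewrite addnS -nE; split => // i ki.
by have [->//|in1] := eqVneq i n.+1; apply: nb; lia.
Qed.

(* The term [M * (n %% m)] pays for the unit steps down to the multiple of [m]
   below [n]; a jump pays for at most [2 * m] unit steps. *)
Lemma greedy_covering n : (n <= N)%N ->
  c n + eps * (\sum_(i < n) bad i.+1)%N%:R <=
  A * n%:R + \sum_(i < n) e i + \sum_(j < n %/ m) r j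
  + 2 * m%:R * M / K%:R * n%:R + M * (n %% m)%N%:R.
Proof.
rewrite -/(B n) -/(E n) -/(S n); set q := 2 * _ * M / _.
have K0' : 0 < K%:R :> R by rewrite ltr0n.
have q0 : 0 <= q by rewrite !mulr_ge0// invr_ge0 ltW.
(* Jumps have length at least [K], so the rate [q] per unit of length collects [2 * m * M] for each
   of them. *)
have qK l : (K <= l)%N -> 2 * m%:R * M <= q * l%:R.
  move=> Kl; apply: (@le_trans _ _ (q * K%:R)); first by rewrite /q divfK// gt_eqF.
  by rewrite ler_wpM2l// ler_nat.
elim/ltn_ind: n => n IH nN.
(* From [n], go down [l < m] unit steps to the bad time [k], then jump to [k - j]. The gain
   [eps * j] pays for all bad times in (k - j, k]; the unit steps and the remainder term at [k - j]
   cost at most [M * m] each, which [qK] covers. *)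
have jump k l : n = (k + l)%N -> bad k -> (l < m)%N ->
    (forall i, (k < i <= k + l)%N -> ~~ bad i) ->
    c n + eps * (B n)%:R <=
      A * n%:R + E n + S n + q * n%:R + M * (n %% m)%N%:R.
  move=> nE bk lm nb; have [|j [Kj jk ck]] := c_bad _ bk; first by lia.
  have nk : n = ((k - j) + (j + l))%N by lia.
  have := IH (k - j)%N; rewrite (_ : _ < _)%N; last by lia.
  rewrite (_ : _ <= _)%N; last by lia.
  move=> /(_ isT isT) IHkj.
  have cn : c n <= c k + M * l%:R + (E n - E k) by rewrite nE c_steps -?nE.
  have BE : B n = B k by rewrite nE B_nobad.
  have Bk : eps * (B k)%:R <= eps * (B (k - j))%:R + eps * j%:R.
    by rewrite -mulrDr ler_wpM2l// -natrD ler_nat -{1}(subnK jk) B_add.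
  have Ek : E (k - j)%N <= E k by apply: le_partial_sum => //; exact: leq_subr.
  have Sk : S (k - j)%N <= S n.
    apply: le_partial_sum => //; apply: leq_div2r.
    by rewrite nE (leq_trans (leq_subr _ _))// leq_addr.
  have lm' : M * l%:R <= M * m%:R by rewrite ler_wpM2l// ler_nat ltnW.
  have mm : M * ((k - j) %% m)%N%:R <= M * m%:R.
    by rewrite ler_wpM2l// ler_nat ltnW// ltn_pmod.
  have qj := qK _ Kj.
  have ql : 0 <= q * l%:R by rewrite mulr_ge0.
  have Al : 0 <= A * l%:R by rewrite mulr_ge0.
  have Mn : 0 <= M * (n %% m)%N%:R by rewrite mulr_ge0.
  have nR : n%:R = (k - j)%N%:R + j%:R + l%:R :> R by rewrite [in LHS]nk !natrD addrA.
  move: IHkj cn ck Bk Ek Sk lm' mm qj ql Al Mn; rewrite BE nR.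
  move: (k - j)%N%:R (n %% m)%N%:R ((k - j) %% m)%N%:R (B k)%:R (B (k - j))%:R.
  move: (E n) (E k) (E (k - j)%N) (S n) (S (k - j)%N) (c n) (c k) (c (k - j)%N).
  move: l%:R j%:R m%:R; clear; move=> *; by lra.
have [->|n0] := posnP n.
  by rewrite c0 /B /E /S div0n mod0n !big_ord0 !mulr0; lra.
(* With no bad time among the last [m], go down a whole block if [m] divides [n], and otherwise a
   unit step, whose cost [M] is the growth of the term in [n %% m]. *)
have noclose : (forall i, (n - m < i <= n)%N -> ~~ bad i) ->
    c n + eps * (B n)%:R <=
      A * n%:R + E n + S n + q * n%:R + M * (n %% m)%N%:R.
  move=> nb; have [mn|mn] := boolP (m %| n)%N.
    have [j nE] := dvdnP mn; have [j' jE] : exists j', j = j'.+1.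
      by case: j nE => [|j' _]; [lia|exists j'].
    subst j n.
    have := IH (j' * m)%N; rewrite (_ : _ < _)%N; last by lia.
    rewrite (_ : _ <= _)%N; last by lia.
    move=> /(_ isT isT) IHj.
    have BE : B (j'.+1 * m) = B (j' * m).
      rewrite (mulSnr j') B_nobad// => i; rewrite -mulSnr => ij; apply: nb.
      by rewrite mulSnr addnK -mulSnr.
    have cj := c_block nN.
    have Ej : E (j' * m)%N <= E (j'.+1 * m)%N.
      by apply: le_partial_sum => //; rewrite leq_mul2r leqnSn orbT.
    have Sj : S (j'.+1 * m)%N = S (j' * m)%N + r j'.
      by rewrite /S !mulnK// big_ord_recr.
    have qj : q * (j' * m)%N%:R <= q * (j'.+1 * m)%N%:R.
      by rewrite ler_wpM2l// ler_nat leq_mul2r leqnSn orbT.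
    move: IHj; rewrite BE Sj !modnMl (mulSnr j') natrD !mulr0 !addr0.
    by move: qj; rewrite (mulSnr j') natrD; move: cj Ej; rewrite mulSnr; lra.
  case: n n0 nN IH jump nb mn => // n _ nN IH _ nb mn.
  have IHn := IH n (ltnSn _) (ltnW nN).
  have BE : B n.+1 = B n.
    by rewrite -addn1 B_nobad// => i; rewrite addn1 => ?; apply: nb; lia.
  have modE : (n.+1 %% m = (n %% m).+1)%N.
    by rewrite modnS (negbTE mn).
  have Sj : S n <= S n.+1 by apply: le_partial_sum => //; apply: leq_div2r.
  have cj := c_step nN.
  have EE : E n.+1 = E n + e n by rewrite /E big_ord_recr.
  move: IHn Sj cj A0 q0; rewrite BE EE modE -(natr1 n) -(natr1 (n %% m)).
  move: n%:R (n %% m)%N%:R (B n)%:R (E n) (S n) (S n.+1) (c n) (c n.+1) (e n).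
  move=> *; lra.
case: (last_bad n) => [nb|[k [l [nE bk nb]]]].
  by apply: noclose => i ?; apply: nb; lia.
case: (ltnP l m) => lm; first exact: jump nE bk lm nb.
by apply: noclose => i /andP[? ?]; apply: nb; lia.
Qed.

End greedy_covering.

(** * Integrals of nonnegative functions *)

Section nonneg_expectation.
Context d (T : measurableType d) (R : realType) (mu : probability T R).
Implicit Types u v : T -> R.

Definition nnmfun u := measurable_fun setT u /\ forall w, 0 <= u w.

Definition nnint u : \bar R := \int[mu]_w (u w)%:E.

Lemma measurable_bool (b : T -> bool) :
  measurable_fun setT b -> measurable [set w | b w].
Proof. by move=> mb; have := mb measurableT [set true] I; rewrite setTI. Qed.

Let mE u : nnmfun u -> measurable_fun setT (EFin \o u).
Proof. by move=> [mu_ _]; exact/measurable_EFinP. Qed.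

Lemma nnmfun_cst (c : R) : 0 <= c -> nnmfun (fun=> c).
Proof. by split=> //; exact: measurable_cst. Qed.

Lemma nnmfunD u v : nnmfun u -> nnmfun v -> nnmfun (fun w => u w + v w).
Proof.
move=> [mu_ u0] [mv v0]; split=> [|w]; last by rewrite addr_ge0.
exact: measurable_funD.
Qed.

Lemma nnmfunZ (c : R) u : 0 <= c -> nnmfun u -> nnmfun (fun w => c * u w).
Proof.
move=> c0 [mu_ u0]; split=> [|w]; last by rewrite mulr_ge0.
by apply: measurable_funM => //; exact: measurable_cst.
Qed.

Lemma nnmfun_sum (I : Type) (s : seq I) (u : I -> T -> R) :
  (forall i, nnmfun (u i)) -> nnmfun (fun w => \sum_(i <- s) u i w).
Proof.
move=> nu; elim: s => [|i s IH].
  by under eq_fun do rewrite big_nil; exact: nnmfun_cst.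
by under eq_fun do rewrite big_cons; exact: nnmfunD.
Qed.

Lemma nnmfun_indic (B : set T) : measurable B -> nnmfun \1_B.
Proof. by move=> mB; split=> [|w]; [exact: measurable_indic|rewrite indicE]. Qed.

Lemma le_nnint u v : nnmfun u -> nnmfun v -> (forall w, u w <= v w) ->
  (nnint u <= nnint v)%E.
Proof.
move=> nu nv uv; apply: ge0_le_integral => //; rewrite ?lee_fin//.
- by move=> w _; rewrite lee_fin; case: nu.
- exact: mE.
- exact: mE.
- by move=> w _; rewrite lee_fin.
Qed.

Lemma nnintD u v : nnmfun u -> nnmfun v ->
  nnint (fun w => u w + v w) = (nnint u + nnint v)%E.
Proof.
move=> nu nv; rewrite /nnint -ge0_integralD//; try exact: mE.
- by move=> w _; rewrite lee_fin; case: nu.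
- by move=> w _; rewrite lee_fin; case: nv.
Qed.

Lemma nnint_cst (c : R) : nnint (fun=> c) = c%:E.
Proof.
rewrite /nnint.
have -> : (\int[mu]_w c%:E)%E = (\int[mu]_(w in setT) cst c%:E w)%E by [].
rewrite integral_cst//.
by rewrite -[RHS]mule1; congr (_ * _)%E; exact: probability_setT.
Qed.

Lemma nnintZ (c : R) u : 0 <= c -> nnmfun u ->
  nnint (fun w => c * u w) = (c%:E * nnint u)%E.
Proof.
move=> c0 nu; rewrite /nnint -ge0_integralZl_EFin//; last exact: mE.
by move=> w _; rewrite lee_fin; case: nu.
Qed.

Lemma nnint_sum (I : Type) (s : seq I) (u : I -> T -> R) :
  (forall i, nnmfun (u i)) ->
  nnint (fun w => \sum_(i <- s) u i w) = (\sum_(i <- s) nnint (u i))%E.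
Proof.
move=> nu; elim: s => [|i s IH].
  rewrite big_nil; transitivity (nnint (fun=> 0)); last exact: nnint_cst.
  by congr nnint; apply/funext => w; rewrite big_nil.
rewrite big_cons -IH -nnintD//; last exact: nnmfun_sum.
by congr nnint; apply/funext => w; rewrite big_cons.
Qed.

Lemma nnint_indic (B : set T) : measurable B -> nnint \1_B = mu B.
Proof. by move=> mB; rewrite /nnint integral_indic// setIT. Qed.

Variables (L : T -> T) (L_mp : measure_preserving mu L).

Lemma measurable_iter k : measurable_fun setT (iter k L).
Proof.
elim: k => [|k IH]; first exact: measurable_id.
by apply: (measurableT_comp _ IH); case: L_mp.
Qed.

Lemma nnmfun_iter k u : nnmfun u -> nnmfun (fun w => u (iter k L w)).
Proof.
by move=> [mu_ u0]; split=> // ; exact: measurableT_comp mu_ (measurable_iter k).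
Qed.

(** Induction on [k]: [mu] agrees with its push-forward by [L] on measurable sets, so one more [L]
    is a change of variables. *)
Lemma nnint_iter k u : nnmfun u -> nnint (fun w => u (iter k L w)) = nnint u.
Proof.
move=> nu; elim: k => // k IH; rewrite -[RHS]IH.
have nk := nnmfun_iter k nu; set v := fun w => u (iter k L w) in nk *.
have [mL pL] := L_mp.
have -> : nnint v = (\int[pushforward mu L]_w (v w)%:E)%E.
  by apply: eq_measure_integral => B mB _; rewrite /= /pushforward pL.
rewrite ge0_integral_pushforward//.
- by rewrite preimage_setT; apply: eq_integral => w _ /=; rewrite /v -iterSr.
- exact: mE.
- by move=> w _; rewrite lee_fin; case: nk.
Qed.

End nonneg_expectation.

Section dominated.
Context d (T : measurableType d) (R : realType) (mu : probability T R).

Lemma dominated_nnint (u : nat -> T -> R) (v : T -> R) (eta : R) :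
  (forall n, nnmfun (u n)) -> nnmfun v -> (nnint mu v < +oo)%E ->
  (forall n w, u n w <= v w) -> {ae mu, forall w, u ^~ w @ \oo --> 0} ->
  0 < eta -> \forall n \near \oo, (nnint mu (u n) <= eta%:E)%E.
Proof.
move=> nu nv v_int uv u_cvg eta0.
have mu_ n : measurable_fun setT (EFin \o u n).
  by case: (nu n) => mu_ _; exact/measurable_EFinP.
have v_integrable : mu.-integrable setT (EFin \o v).
  have [mv v0] := nv; apply/integrableP; split; first exact/measurable_EFinP.
  by under eq_integral do rewrite /= ger0_norm//.
have := @dominated_convergence _ _ _ mu setT measurableT
  (fun n => EFin \o u n) (cst 0%E) (EFin \o v) mu_ (measurable_cst _) _
  v_integrable.
case=> [||_ _].
- move: u_cvg; apply: filterS => w uw _; apply: cvg_comp uw _.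
  by move=> B.
- apply: aeW => w n _ /=; rewrite lee_fin ger0_norm ?uv//; by case: (nu n).
rewrite integral0 => H.
have : nbhs (0%E : \bar R) [set y | (y < eta%:E)%E].
  by apply: open_nbhs_nbhs; split; [exact: open_ereal_lt_ereal|rewrite /= lte_fin].
move=> /H hn; near=> n; apply: ltW; near: n; exact: hn.
Unshelve. all: by end_near. Qed.

End dominated.

(** * Subadditive processes: convergence in mean to the drift *)

Section subadditive_process.
Context d (T : measurableType d) (R : realType) (mu : probability T R).
Variables (L : T -> T) (a : nat -> T -> R) (A : R).
Hypothesis L_mp : measure_preserving mu L.
Hypothesis ma : forall n, nnmfun (a n).
Hypothesis a00 : forall w, a 0%N w = 0.
Hypothesis aD : forall n m w, a (n + m)%N w <= a n w + a m (iter n L w).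
Hypothesis a1_int : (nnint mu (a 1%N) < +oo)%E.
Hypothesis A0 : 0 <= A.
Hypothesis drift :
  {ae mu, forall w, (fun n : nat => n%:R^-1 * a n w) @ \oo --> A}.

Let a0 n w : 0 <= a n w. Proof. by case: (ma n). Qed.

(** What a unit step costs beyond [M]. Along the orbit, [excess] and [deviation] become the errors
    [e] and [r] of the covering. *)
Definition excess (M : R) w : R := Num.max (a 1%N w - M) 0.

Lemma nnmfun_excess M : nnmfun (excess M).
Proof.
split=> [|w]; last by rewrite le_max lexx orbT.
apply: measurable_maxr; last exact: measurable_cst.
by apply: measurable_funB; [case: (ma 1%N)|exact: measurable_cst].
Qed.

Definition deviation n w : R := `|a n w - A * n%:R|.

Lemma nnmfun_deviation n : nnmfun (deviation n).
Proof.
split=> [|w]; last exact: normr_ge0.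
apply: measurableT_comp => //.
by apply: measurable_funB; [case: (ma n)|exact: measurable_cst].
Qed.

Lemma subadditive_le_sum n w : a n w <= \sum_(i < n) a 1%N (iter i L w).
Proof.
elim: n => [|n IH]; first by rewrite a00 big_ord0.
by rewrite big_ord_recr /= -addn1 (le_trans (aD _ _ _))// lerD2r.
Qed.

(** Dominated convergence along integer levels: the excess over [n] is at most [a 1], and it
    vanishes once [n] exceeds [a 1 w]. *)
Lemma excess_small (eta : R) : 0 < eta ->
  exists2 M : R, A <= M & (nnint mu (excess M) <= eta%:E)%E.
Proof.
move=> eta0.
have small : \forall n \near \oo, (nnint mu (excess n%:R) <= eta%:E)%E.
  apply: dominated_nnint a1_int _ _ eta0 => // [n||].
  - exact: nnmfun_excess.
  - by move=> n w; rewrite /excess ge_max a0 andbT gerBl.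
  apply: aeW => w; apply: cvg_near_cst; near=> n.
  rewrite /excess; apply: max_r; rewrite subr_le0; near: n; exact: nbhs_infty_ger.
have [n [An nM]] := filter_ex (filterI (nbhs_infty_ger A) small).
by exists n%:R.
Unshelve. all: by end_near. Qed.

(** Cut off at [M], the quotient of [a n] by [n] is bounded and still converges to [A]. By
    subadditivity the part cut off is at most the sum of the excesses along the orbit, whose mean is
    at most [n * eta / 2] by invariance. *)
Lemma deviation_small (eta : R) : 0 < eta ->
  \forall n \near \oo, (nnint mu (deviation n) <= (eta * n%:R)%:E)%E.
Proof.
move=> eta0; have [M AM Mint] := @excess_small (eta / 2) ltac:(by rewrite divr_gt0).
have M0 : 0 <= M by exact: le_trans AM.
have minM (x : R) : 0 <= x -> `|Num.min x M - A| <= M.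
  have A0' : 0 <= A by exact: A0.
  by move=> x0; rewrite ler_norml; have [xM|xM] := leP x M; apply/andP; split; lra.
pose u n w : R := `|Num.min (n%:R^-1 * a n w) M - A|.
have nu n : nnmfun (u n).
  split=> [|w]; last exact: normr_ge0.
  apply: measurableT_comp => //; apply: measurable_funB => //.
  apply: measurable_minr => //; apply: measurable_funM => //.
  by case: (ma n).
have small : \forall n \near \oo, (nnint mu (u n) <= (eta / 2)%:E)%E.
  apply: (@dominated_nnint _ _ _ mu u (fun=> M)) => //.
  - by rewrite nnint_cst ltry.
  - by move=> n w; apply: minM; rewrite mulr_ge0// invr_ge0.
  - move: drift; apply: filterS => w aA.
    have absA : `|n%:R^-1 * a n w - A| @[n --> \oo] --> 0.
      rewrite -(normr0 R) -(subrr A); apply: cvg_norm.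
      by apply: cvgB => //; exact: cvg_cst.
    (* As [A <= M], cutting at [M] cannot increase the distance to [A]. *)
    apply: (squeeze_cvgr _ (cvg_cst 0) absA); near=> n.
    rewrite normr_ge0 /u /=; have [//|xM] := leP (n%:R^-1 * a n w) M.
    by rewrite !ger0_norm ?lerD2r ?subr_ge0// ltW// (le_lt_trans AM).
  - by rewrite divr_gt0.
near=> n; have n0 : (0 < n)%N by near: n; exact: nbhs_infty_gt.
have n0' : 0 < n%:R :> R by rewrite ltr0n.
have un : (nnint mu (u n) <= (eta / 2)%:E)%E by near: n.
have nex i : nnmfun (fun w => excess M (iter i L w)).
  by apply: (nnmfun_iter L_mp); exact: nnmfun_excess.
have le w : deviation n w <= n%:R * u n w + \sum_(i < n) excess M (iter i L w).
  have exc : a n w - M * n%:R <= \sum_(i < n) excess M (iter i L w).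
    rewrite lerBlDr (le_trans (subadditive_le_sum n w))//.
    have -> : M * n%:R = \sum_(i < n) M by rewrite sumr_const card_ord mulr_natr.
    rewrite -big_split /=; apply: ler_sum => i _.
    by rewrite -lerBlDr /excess le_max lexx.
  have exc0 : 0 <= \sum_(i < n) excess M (iter i L w).
    by apply: sumr_ge0 => i _; case: (nex i).
  have uE : n%:R * u n w = `|Num.min (a n w) (M * n%:R) - A * n%:R|.
    rewrite /u -{1}(gtr0_norm n0') -normrM mulrBr minr_pMr ?ltW// mulrA divff ?gt_eqF//.
    by rewrite mul1r ![n%:R * _]mulrC.
  rewrite uE /deviation; have AMn : A * n%:R <= M * n%:R by rewrite ler_pM2r.
  have [aM|aM] := leP (a n w) (M * n%:R); first by rewrite lerDl.
  by rewrite !ger0_norm; lra.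
have nu' : nnmfun (fun w => n%:R * u n w) by exact: nnmfunZ.
have ns := nnmfun_sum (index_enum 'I_n) nex.
apply: (le_trans (le_nnint mu (nnmfun_deviation n) (nnmfunD nu' ns) le)).
rewrite nnintD// nnintZ// nnint_sum//.
under eq_bigr do rewrite (nnint_iter L_mp _ (nnmfun_excess M)).
have -> : (eta * n%:R)%:E =
    (n%:R%:E * (eta / 2)%:E + \sum_(i < n) (eta / 2)%:E)%E :> \bar R.
  rewrite sumEFin -EFinM -EFinD sumr_const card_ord -mulr_natr; congr EFin; lra.
by apply: leeD; [rewrite lee_pmul2l|apply: lee_sum].
Unshelve. all: by end_near. Qed.

End subadditive_process.

(** * Density of bad times *)

Section bad_times.
Context d (T : measurableType d) (R : realType) (mu : probability T R).
Variables (L : T -> T) (a : nat -> T -> R) (A : R).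
Hypothesis L_mp : measure_preserving mu L.
Hypothesis ma : forall n, nnmfun (a n).
Hypothesis a00 : forall w, a 0%N w = 0.
Hypothesis aD : forall n m w, a (n + m)%N w <= a n w + a m (iter n L w).
Hypothesis a1_int : (nnint mu (a 1%N) < +oo)%E.
Hypothesis A0 : 0 <= A.
Hypothesis drift :
  {ae mu, forall w, (fun n : nat => n%:R^-1 * a n w) @ \oo --> A}.

Definition bad_time K (eps : R) n : set T :=
  \bigcup_(l in [set l | (K <= l <= n)%N])
    [set w | a n w - a (n - l)%N (iter l L w) < (A - eps) * l%:R].

Lemma measurable_bad K eps n : measurable (bad_time K eps n).
Proof.
apply: bigcup_measurable => l _.
apply: (@measurable_bool _ _ (fun w => a n w - _ < _)); apply: measurable_fun_ltr => //.
by apply: measurable_funB; [case: (ma n)|case: (nnmfun_iter L_mp l (ma (n - l)))].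
Qed.

(* Reading the orbit of [w] backwards from time [N] makes the jumps of the
   covering start from the points [iter (N - n) L w], which have the law [mu]. *)
Lemma sum_bad_le K (eps : R) m N (M : R) : (0 < m)%N -> (0 < K)%N -> 0 <= eps -> A <= M ->
  (nnint mu (a N) + eps%:E * \sum_(i < N) mu (bad_time K eps i.+1) <=
   (A * N%:R + 2 * m%:R * M / K%:R * N%:R + M * m%:R)%:E
   + N%:R%:E * nnint mu (excess a M)
   + (N %/ m)%:R%:E * nnint mu (deviation a A m))%E.
Proof.
move=> m0 K0 eps0 AM; have M0 : 0 <= M by exact: le_trans AM.
pose e i w : R := excess a M (iter (N - i.+1) L w).
pose r j w : R := deviation a A m (iter (N - j.+1 * m) L w).
pose b i w : R := \1_(bad_time K eps i.+1) (iter (N - i.+1) L w).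
have ne i : nnmfun (e i) by exact/(nnmfun_iter L_mp)/nnmfun_excess.
have nr j : nnmfun (r j) by exact/(nnmfun_iter L_mp)/nnmfun_deviation.
have nb i : nnmfun (b i).
  exact/(nnmfun_iter L_mp)/nnmfun_indic/measurable_bad.
set c0 := A * N%:R + _ + _.
have c00 : 0 <= c0 by rewrite !addr_ge0// !mulr_ge0// invr_ge0.
have le w : a N w + eps * \sum_(i < N) b i w <=
    c0 + \sum_(i < N) e i w + \sum_(j < N %/ m) r j w.
  (* Passing from [n] to [k + n] prolongs the orbit segment at its start, so subadditivity charges
     [a k] at the earlier point [iter (N - (k + n)) L w]. *)
  pose c n := a n (iter (N - n) L w).
  pose B := [pred n | `[< bad_time K eps n (iter (N - n) L w) >]].
  have cN : c N = a N w by rewrite /c subnn.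
  have BN : (\sum_(i < N) B i.+1)%N%:R = \sum_(i < N) b i w.
    rewrite natr_sum; apply: eq_bigr => i _.
    by rewrite /b indicE.
  have back k n : (k + n <= N)%N ->
      iter (N - n) L w = iter k L (iter (N - (k + n)) L w).
    by move=> knN; rewrite -iterD (_ : (k + (N - (k + n)))%N = (N - n)%N)//; lia.
  have := @greedy_covering R A eps M c (e ^~ w) (r ^~ w) B m K N m0 K0 A0 eps0 M0.
  move=> /(_ _ _ _ _ _ _ N (leqnn N)); rewrite cN BN => cover.
  apply: le_trans (cover _ _ _ _ _ _) _ =>
    [i|i||n nN|j jN|n nN /asboolP[l /= /andP[Kl ln] h]|].
  - by case: (ne i).
  - by case: (nr i).
  - by rewrite /c a00.
  - rewrite /c /e (back 1%N n)// add1n -add1n (le_trans (aD _ _ _))//=.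
    by rewrite addrC -addrA lerD2l -lerBlDl /excess le_max lexx.
  - rewrite /c /r /deviation (back m (j * m)%N) -?mulSn// mulSn (le_trans (aD _ _ _))//=.
    by rewrite addrC -addrA lerD2l -lerBlDl ler_norm.
  (* Badness at the point [iter (N - n) L w] compares [a n] there with [a (n - l)] at its [l]-th
     iterate, and the latter is [c (n - l)]. *)
  - exists l; split => //.
    rewrite /c -lerBlDl.
    have -> : (N - (n - l) = l + (N - n))%N by rewrite subnBA// addnC addnBA.
    by rewrite iterD ltW.
  - have : M * (N %% m)%N%:R <= M * m%:R.
      by rewrite ler_wpM2l// ler_nat ltnW// ltn_pmod.
    by rewrite /c0; lra.
have -> : (nnint mu (a N) + eps%:E * \sum_(i < N) mu (bad_time K eps i.+1) =
    nnint mu (fun w => a N w + eps * \sum_(i < N) b i w)%R)%E.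
  rewrite nnintD//; last by apply: nnmfunZ => //; exact: nnmfun_sum.
  rewrite nnintZ//; last exact: nnmfun_sum.
  rewrite nnint_sum//; congr (_ + _ * _)%E; apply: eq_bigr => i _.
  have mb := nnmfun_indic R (measurable_bad K eps i.+1).
  by rewrite (nnint_iter L_mp _ mb) nnint_indic//; exact: measurable_bad.
have nsb : nnmfun (fun w => \sum_(i < N) b i w) by exact: nnmfun_sum.
have nse : nnmfun (fun w => \sum_(i < N) e i w) by exact: nnmfun_sum.
have nsr : nnmfun (fun w => \sum_(j < N %/ m) r j w) by exact: nnmfun_sum.
have nc := nnmfun_cst T c00.
apply: (le_trans (le_nnint mu _ _ le)); [|by do 2 apply: nnmfunD => //|].
  by apply: nnmfunD => //; exact: nnmfunZ.
rewrite nnintD//; last exact: nnmfunD.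
rewrite nnintD// nnint_cst !nnint_sum//.
under eq_bigr do rewrite (nnint_iter L_mp _ (nnmfun_excess ma M)).
under [X in (_ + X <= _)%E]eq_bigr do
  rewrite (nnint_iter L_mp _ (nnmfun_deviation A ma m)).
rewrite !sumr_const !card_ord.
by rewrite !mule_natl.
Qed.

(** For large [N] the mean of [a N] is at least [(A - eta) * N], which cancels the main term of
    [sum_bad_le]. Five errors of size [eta * N] remain, hence the 5 in [eta]. The constants are
    chosen in the order [M], [m], [K]. *)
Lemma bad_density (eps delta : R) : 0 < eps -> 0 < delta ->
  exists2 K, (0 < K)%N &
    forall N, (\sum_(i < N) mu (bad_time K eps i.+1) <= (delta * N%:R)%:E)%E.
Proof.
move=> eps0 delta0; pose eta := eps * delta / 5.
have eta0 : 0 < eta by rewrite divr_gt0// mulr_gt0.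
have [M AM eM] := excess_small A ma a1_int eta0.
have M0 : 0 <= M by exact: le_trans AM.
have dev := deviation_small L_mp ma a00 aD a1_int A0 drift eta0.
have [m [m0 dm]] := filter_ex (filterI (nbhs_infty_gt 0) dev).
have [N1 _ dN] := dev.
(* [K >= N1] gives the deviation bound at every [N >= K]; [K >= 2 * m * M / eta] absorbs the jump
   term and [M * m]. *)
have [K [N1K [K0 MK]]] := filter_ex (filterI (nbhs_infty_ge N1)
  (filterI (nbhs_infty_gt 0) (nbhs_infty_ger (2 * m%:R * M / eta)))).
exists K => // N.
have m0' : 0 < m%:R :> R by rewrite ltr0n.
have K0' : 0 < K%:R :> R by rewrite ltr0n.
(* For [N < K] no time up to [N] is bad, since a witness would satisfy [K <= l <= N]. *)
have [NK|KN] := ltnP N K.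
  rewrite big1 ?lee_fin ?mulr_ge0 ?(ltW delta0)// => i _.
  rewrite (_ : bad_time _ _ _ = set0) ?measure0// -subset0 => w [l /= /andP[Kl li] _].
  by have := leq_ltn_trans (leq_trans Kl (leq_trans li (ltn_ord i))) NK; rewrite ltnn.
have /dN aN : (N1 <= N)%N by exact: leq_trans KN.
have sE : (\sum_(i < N) mu (bad_time K eps i.+1) =
    (\sum_(i < N) fine (mu (bad_time K eps i.+1)))%R%:E)%E.
  rewrite -sumEFin; apply: eq_bigr => i _.
  by rewrite fineK// fin_num_measure//; exact: measurable_bad.
have := sum_bad_le N m0 K0 (ltW eps0) AM.
rewrite sE -EFinM; set S := \sum_(i < N) _ => le.
have AN : ((A * N%:R)%:E <= nnint mu (a N) + (eta * N%:R)%:E)%E.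
  have := le_nnint mu (nnmfun_cst T (_ : 0 <= A * N%:R))
    (nnmfunD (ma N) (nnmfun_deviation A ma N)).
  rewrite nnint_cst nnintD//; last exact: nnmfun_deviation.
  move=> /(_ _ _)/le_trans; apply; first by rewrite mulr_ge0.
    by move=> w; rewrite /deviation -lerBlDl distrC ler_norm.
  by rewrite leeD2l.
have up : (nnint mu (a N) + (eps * S)%:E <=
    (A * N%:R + 2 * m%:R * M / K%:R * N%:R + M * m%:R + N%:R * eta
     + (N %/ m)%:R * (eta * m%:R))%:E)%E.
  apply: (le_trans le); rewrite [leRHS]EFinD; apply: leeD; last first.
    by rewrite EFinM lee_wpmul2l// lee_fin.
  by rewrite [leRHS]EFinD leeD2l// EFinM lee_wpmul2l// lee_fin.
(* The two bounds are chained by addition, so that [nnint mu (a N)] is never subtracted in the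
   extended reals. *)
have := leeD AN (lexx (eps * S)%:E); rewrite addeAC => /le_trans.
move=> /(_ _ (leeD up (lexx _))); rewrite -!EFinD lee_fin => {le AN up} le.
have MK' : 2 * m%:R * M <= eta * K%:R by rewrite -ler_pdivrMl// mulrC.
have q1 : 2 * m%:R * M / K%:R * N%:R <= eta * N%:R.
  by rewrite ler_wpM2r// ler_pdivrMr.
have q2 : M * m%:R <= eta * N%:R.
  have : eta * K%:R <= eta * N%:R by rewrite (ler_wpM2l (ltW eta0))// ler_nat.
  have : 0 <= m%:R * M by rewrite mulr_ge0.
  by lra.
have q3 : (N %/ m)%:R * (eta * m%:R) <= eta * N%:R.
  by rewrite mulrCA (ler_wpM2l (ltW eta0))// -natrM ler_nat leq_divM.
rewrite lee_fin -(ler_pM2l eps0) mulrA.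
have -> : eps * delta = 5 * eta by rewrite /eta; field.
by lra.
Qed.

End bad_times.

(** * From low density of bad times to infinitely many good times *)

Section limsup_density.
Context d (T : measurableType d) (R : realType) (mu : probability T R).

Lemma measurable_lim_sup_set (F : (set T)^nat) :
  (forall n, measurable (F n)) -> measurable (lim_sup_set F).
Proof.
by move=> mF; apply: bigcap_measurable => // n _; exact: bigcup_measurable.
Qed.

Lemma lim_sup_setP (F : (set T)^nat) w :
  lim_sup_set F w <-> forall N, exists2 n, (N <= n)%N & F n w.
Proof.
split=> [h N|h N _]; first by have [n /= Nn Fn] := h N I; exists n.
by have [n Nn Fn] := h N; exists n.
Qed.

(** If the complements of the [B k] with [k >= n] had a union of measure below [1 - 2 * delta], the
    rest of the space would have measure above [2 * delta] and lie in every such [B k]. Summing over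
    the first [n + n.+1] indices, more than half of which are at least [n], contradicts the density
    bound. The tail unions decrease to the limsup set. *)
Lemma limsup_density (B : (set T)^nat) (delta : R) : 0 <= delta ->
  (forall n, measurable (B n)) ->
  (forall N, (\sum_(i < N) mu (B i) <= (delta * N%:R)%:E)%E) ->
  ((1 - 2 * delta)%:E <= mu (lim_sup_set (fun n => ~` B n)))%E.
Proof.
move=> delta0 mB dB.
have mF n : measurable (\bigcup_(k in [set k | (n <= k)%N]) ~` B k).
  by apply: bigcup_measurable => k _; exact: measurableC.
have mC k : measurable (~` B k) by exact: measurableC.
have F0 : (mu (\bigcup_(k in [set k | (0 <= k)%N]) ~` B k) < +oo)%E.
  by rewrite (le_lt_trans (probability_le1 mu (mF 0%N))) ?ltry.
apply: (cvge_to_ge (lim_sup_set_cvg mu (fun n => ~` B n) mC F0)).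
near=> n; set F := \bigcup_(k in _) _.
rewrite leNgt; apply/negP => Fsmall.
pose p := fine (mu (~` F)).
have pE : mu (~` F) = p%:E by rewrite fineK// fin_num_measure//; exact/measurableC/mF.
have p2 : 2 * delta < p.
  rewrite -lte_fin -pE probability_setC; last exact: mF.
  have Ffin : mu F \is a fin_num by rewrite fin_num_measure//; exact: mF.
  have Fsmall' : fine (mu F) < 1 - 2 * delta by rewrite -lte_fin fineK.
  by rewrite -(fineK Ffin) -EFinB lte_fin ltrBrDl -ltrBrDr.
have Bk k : (n <= k)%N -> (p%:E <= mu (B k))%E.
  move=> nk; rewrite -pE; apply: le_measure; rewrite ?inE//.
    exact/measurableC/mF.
  by move=> w /= Fw; apply: contrapT => Bw; apply: Fw; exists k.
have := dB (n + n.+1)%N; rewrite big_split_ord /=.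
have le : ((p * n.+1%:R)%:E <= \sum_(i < n.+1) mu (B (n + i)%N))%E.
  have -> : ((p * n.+1%:R)%:E = \sum_(i < n.+1) p%:E)%E.
    by rewrite sumEFin sumr_const card_ord mulr_natr.
  by apply: lee_sum => i _; apply: Bk; exact: leq_addr.
have le0 : (0 <= \sum_(i < n) mu (B i))%E by apply: sume_ge0.
move=> /(le_trans (leeD le0 le)); rewrite add0e lee_fin natrD.
have : 2 * delta * n.+1%:R < p * n.+1%:R by rewrite ltr_pM2r// ?ltr0n.
by rewrite -(natr1 n); lra.
Unshelve. all: by end_near. Qed.

(** Countable subadditivity, with geometric weights adding up to [delta]. *)
Lemma bigcup_density (B : nat -> (set T)^nat) (delta : R) : 0 <= delta ->
  (forall i n, measurable (B i n)) ->
  (forall i N, (\sum_(n < N) mu (B i n) <= (delta / (2 ^ i.+1)%:R * N%:R)%:E)%E) ->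
  forall N, (\sum_(n < N) mu (\bigcup_i B i n) <= (delta * N%:R)%:E)%E.
Proof.
move=> delta0 mB dB N.
have step : (\sum_(n < N) mu (\bigcup_i B i n) <=
    \sum_(n < N) \sum_(0 <= i <oo) mu (B i n))%E.
  apply: lee_sum => n _; apply: measure_sigma_subadditive => //.
  exact: bigcupT_measurable.
apply: (le_trans step); rewrite -nneseries_sum//.
have Nd0 : 0 <= delta * N%:R by rewrite mulr_ge0.
apply: (le_trans _ (epsilon_trick0 xpredT Nd0)).
apply: lee_nneseries => [i _ _|i _]; first exact: sume_ge0.
by apply: (le_trans (dB i N)); rewrite lee_fin mulrAC.
Qed.

End limsup_density.

Section good_times.
Context d (T : measurableType d) (R : realType) (mu : probability T R).
Variables (L : T -> T) (a : nat -> T -> R) (A : R).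
Hypothesis L_mp : measure_preserving mu L.
Hypothesis ma : forall n, nnmfun (a n).
Hypothesis a00 : forall w, a 0%N w = 0.
Hypothesis aD : forall n m w, a (n + m)%N w <= a n w + a m (iter n L w).
Hypothesis a1_int : (nnint mu (a 1%N) < +oo)%E.
Hypothesis A0 : 0 <= A.
Hypothesis drift :
  {ae mu, forall w, (fun n : nat => n%:R^-1 * a n w) @ \oo --> A}.

(** [K] may depend on [w] and [eps] but not on [n]; this encodes the sequence [eps_l -> 0]. *)
Let good (G : (set T)^nat) w := forall eps : R, 0 < eps ->
  exists K, forall n l, G n w -> (K <= l <= n)%N ->
    (A - eps) * l%:R <= a n w - a (n - l)%N (iter l L w).

(** All [eps] of the form [i.+1%:R^-1] are treated at once: the [i]-th is allotted density
    [delta / 2 ^ i.+1], and a time is kept when it is bad for none of them. *)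
Let good_times_delta (delta : R) : 0 < delta -> exists G : (set T)^nat,
  [/\ forall n, measurable (G n), ((1 - 2 * delta)%:E <= mu (lim_sup_set G))%E &
      forall w, good G w].
Proof.
move=> delta0.
have /choice[K KP] : forall i : nat, exists K, forall N,
    (\sum_(n < N) mu (bad_time L a A K i.+1%:R^-1 n.+1) <=
      (delta / (2 ^ i.+1)%:R * N%:R)%:E)%E.
  move=> i; have [||K _ KP] := @bad_density _ _ _ mu L a A L_mp ma a00 aD a1_int
    A0 drift i.+1%:R^-1 (delta / (2 ^ i.+1)%:R).
  - by rewrite invr_gt0.
  - by rewrite divr_gt0// ltr0n expn_gt0.
  - by exists K.
pose B n := \bigcup_i bad_time L a A (K i) i.+1%:R^-1 n.
have mB n : measurable (B n).
  by apply: bigcupT_measurable => i; exact: (measurable_bad A L_mp ma).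
(* The density bounds concern times from 1 on; time 0 is discarded. *)
exists (fun n => if n is n'.+1 then ~` B n'.+1 else set0); split.
- by case=> [|n]; [exact: measurable0|exact: measurableC].
- apply: (@le_trans _ _ (mu (lim_sup_set (fun n => ~` B n.+1)))).
    apply: limsup_density; [exact: ltW|by move=> n; exact: mB|].
    apply: (@bigcup_density _ _ _ mu
      (fun i n => bad_time L a A (K i) i.+1%:R^-1 n.+1)) => //; first exact: ltW.
    by move=> i n; exact: (measurable_bad A L_mp ma).
  apply: le_measure; rewrite ?inE.
  + by apply: measurable_lim_sup_set => n; exact: measurableC.
  + by apply: measurable_lim_sup_set => -[|n]; [exact: measurable0|exact: measurableC].
  + move=> w /lim_sup_setP wB; apply/lim_sup_setP => N.
    by have [n Nn nB] := wB N; exists n.+1 => //; exact: leqW.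
- move=> w eps eps0.
  have [i iE] : exists i : nat, i.+1%:R^-1 <= eps.
    by have [i /ltW ieps] := filter_ex (near_infty_natSinv_lt (PosNum eps0)); exists i.
  exists (K i) => -[//|n] l Bn Kl; rewrite leNgt; apply/negP => lt.
  apply: Bn; exists i => //; exists l => //=; apply: (lt_le_trans lt).
  by rewrite ler_wpM2r// lerD2l lerN2.
Qed.

(** The sets [D_ q] have measure at least [1 - 2 / q.+1], so their union has full measure. A point
    of the union uses only the times attached to the first [D_ q] containing it, so that one [K]
    serves for each [eps]. *)
Lemma good_times : exists (D : set T) (G : (set T)^nat),
  [/\ measurable D, mu D = 1%E, forall n, measurable (G n),
      D `<=` lim_sup_set G & D `<=` good G].
Proof.
have /choice[G GP] := fun q : nat =>
  @good_times_delta q.+1%:R^-1 ltac:(by rewrite invr_gt0).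
pose D_ q := lim_sup_set (G q).
have mD_ q : measurable (D_ q) by apply: measurable_lim_sup_set; case: (GP q).
have mS q : measurable (seqDU D_ q).
  by apply: measurableD => //; exact: bigsetU_measurable.
exists (\bigcup_q D_ q), (fun n => \bigcup_q (seqDU D_ q `&` G q n)); split.
- exact: bigcupT_measurable.
- apply/eqP; rewrite eq_le probability_le1 /=; last exact: bigcupT_measurable.
  apply/lee_addgt0Pr => eps eps0.
  have [q qE] : exists q : nat, q.+1%:R^-1 <= eps / 2.
    have e2 : 0 < eps / 2 by rewrite divr_gt0.
    by have [i /ltW ieps] := filter_ex (near_infty_natSinv_lt (PosNum e2)); exists i.
  have [_ Gq _] := GP q.
  have : (mu (D_ q) <= mu (\bigcup_q D_ q))%E.
    by apply: le_measure; rewrite ?inE//; [exact: bigcupT_measurable|exact: bigcup_sup].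
  move=> /(le_trans Gq)/(@leeD _ _ _ eps%:E eps%:E)/(_ (lexx _)); apply: le_trans.
  by rewrite -EFinD lee_fin -addrA lerDl addrC subr_ge0 mulrC -ler_pdivlMr.
- move=> n; apply: bigcupT_measurable => q; apply: measurableI => //.
  by case: (GP q).
- rewrite seqDU_bigcup_eq => w [q _ qw]; apply/lim_sup_setP => N.
  have /lim_sup_setP/(_ N)[n Nn nG] : D_ q w by case: qw.
  by exists n => //; exists q.
- rewrite seqDU_bigcup_eq => w [q _ qw] eps eps0.
  have [_ _ /(_ w eps eps0)[K KP]] := GP q.
  exists K => n l [q' _ [q'w Gn]]; apply: KP.
  have qq' := @trivIset_seqDU _ D_ q q' I I (ex_intro _ w (conj qw q'w)).
  by rewrite qq'.
Qed.

End good_times.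

(** * Horofunctions *)

Section dense_sequence.
Context {R : realType} (X : metricType R).

(** Lists ordered by inclusion generate a filter, and near [x] every list containing [x] is a net;
    compactness in near-covering form yields one list for all of [K]. *)
Lemma compact_net (K : set X) (e : R) : 0 < e -> compact K ->
  exists s : seq X, forall x, K x -> exists2 y, y \in s & mdist y x < e.
Proof.
move=> e0 /compact_near_coveringP cK.
pose F := filter_from [set: seq X] (fun s0 => [set s : seq X | {subset s0 <= s}]).
have FF : Filter F.
  apply: filter_from_filter; first by exists [::].
  move=> s1 s2 _ _; exists (s1 ++ s2) => // s /= s12.
  by split=> x xs; apply: s12; rewrite mem_cat xs ?orbT.
have [x Kx|s _ sP] := cK _ F (fun (s : seq X) x => exists2 y, y \in s & mdist y x < e) FF.
  exists ([set y | mdist x y < e], [set s : seq X | {subset [:: x] <= s}]).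
    split; last by exists [:: x].
    by have := nbhsx_ballx x e e0; rewrite ballEmdist.
  by move=> [y s] /= [xy xs]; exists x => //; apply: xs; rewrite inE.
by exists s; exact: sP.
Qed.

Definition dense_seq (z : nat -> X) := forall x (e : R), 0 < e ->
  exists j, mdist (z j) x < e.

Lemma proper_dense_seq (x0 : X) : proper_space X -> exists z, dense_seq z.
Proof.
move=> pX.
pose B (n : nat) := [set x : X | mdist x0 x <= n%:R].
have cB n : compact (B n).
  apply: pX.
    rewrite (_ : B n = mdist x0 @^-1` [set r | r <= n%:R])//.
    apply: closed_comp; last exact: closed_le.
    move=> x _; have := @ndist_continuous R X x0 x0 x.
    by rewrite /ndist; under eq_fun do rewrite mdistxx subr0.
  exists (n%:R + n%:R) => x y xB yB; rewrite (le_trans (metric_triangle x x0 y))//.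
  by rewrite lerD// metric_sym.
have /choice[s sP] : forall nk : nat * nat, exists s : seq X,
    forall x, B nk.1 x -> exists2 y, y \in s & mdist y x < nk.2.+1%:R^-1.
  by move=> [n k]; apply: compact_net; rewrite ?invr_gt0//; exact: cB.
(* [z] runs through the [k.+1%:R^-1]-nets of all balls [B n], coded by triples; the other codes give
   [x0]. *)
pose z (j : nat) := if @unpickle (nat * nat * nat)%type j is Some (nk, i)
  then nth x0 (s nk) i else x0.
exists z => x e e0.
have [n [xn ne]] := filter_ex (filterI (nbhs_infty_ger (mdist x0 x))
  (near_infty_natSinv_lt (PosNum e0))).
have [y ys yx] := sP (n, n) x xn.
exists (pickle ((n, n), index y (s (n, n)))).
by rewrite /z pickleK nth_index//; exact: lt_trans yx ne.
Qed.

End dense_sequence.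

Section lipschitz_functions.
Context {R : realType} {X : metricType R}.

Definition lip1 (f : X -> R) := forall x y, `|f x - f y| <= mdist x y.

Lemma lip1_continuous f : lip1 f -> continuous f.
Proof.
move=> lf x; apply/cvgrPdist_lt => e e0.
have : nbhs x [set y | mdist x y < e].
  by have := nbhsx_ballx x e e0; rewrite ballEmdist.
by apply: filterS => y; exact: le_lt_trans.
Qed.

Lemma lip1_ndist (x0 x : X) : lip1 (ndist x0 x).
Proof.
move=> y z; rewrite /ndist opprB addrA subrK ler_norml lerBrDr lerBlDr.
have := metric_triangle x y z; have := metric_triangle x z y.
by rewrite (metric_sym z y) => ? ?; apply/andP; split; lra.
Qed.

Lemma norm_ndist (x0 x z : X) : `|ndist x0 x z| <= mdist x0 z.
Proof.
have := lip1_ndist x0 x z x0.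
by rewrite {2}/ndist subrr subr0 metric_sym.
Qed.

(** The [lip1] functions are equicontinuous, and on an equicontinuous family pointwise convergence
    is uniform on compact sets. *)
Lemma lip1_family_cvg (F : set_system (X -> R)) (f : X -> R) : ProperFilter F ->
  F lip1 -> (forall x, g x @[g --> F] --> f x) -> {family compact, F --> f}.
Proof.
move=> PF Flip Ff.
have ptws_f : {ptws, F --> f} by apply/pointwise_cvgP.
suff /(pointwise_compact_cvg f PF)[+ _] :
  \forall W \near powerset_filter_from F, equicontinuous W id by exact.
apply/near_powerset_filter_fromP; first exact: equicontinuous_subset_id.
exists lip1 => // x E; rewrite -entourage_ballE => -[e /= e0 eE].
have : nbhs x [set y | mdist x y < e].
  by have := nbhsx_ballx x e e0; rewrite ballEmdist.
apply: filterS => y xy g lg; apply: eE => /=.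
by rewrite /ball /=; exact: le_lt_trans (lg x y) xy.
Qed.

End lipschitz_functions.

Section hspace.
Context {R : realType} {X : metricType R} (x0 : X).

Lemma cfun_cvg (F : set_system (cfun X)) (f : cfun X) : ProperFilter F ->
  {family compact, cfun_fun @ F --> cfun_fun f} -> F --> f.
Proof.
move=> PF Ff B.
rewrite nbhsE => -[U [[V oV VU] Uf] UB].
rewrite nbhs_filterE.
have /Ff : nbhs (cfun_fun f : {family compact, X -> R}) V.
  by apply: open_nbhs_nbhs; split => //; move: Uf; rewrite -VU.
move=> FV; have VB : cfun_fun @^-1` V `<=` B by move=> g Vg; apply: UB; rewrite -VU.
exact: (@filterS _ F _ _ _ VB FV).
Qed.

Lemma cfun_eval_continuous (z : X) : continuous (fun f : cfun X => cfun_fun f z).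
Proof.
move=> f.
have fam : {family compact, cfun_fun @ nbhs f --> cfun_fun f}.
  exact: (@initial_continuous _ {family compact, X -> R}
    (fun f : continuousType X R => (f : X -> R) : {family compact, X -> R}) f).
have [/(_ (pointwise_cvg_compact_family _ fam) z)] :=
  @pointwise_cvgP X R (cfun_fun @ nbhs f) (cfun_fun f) _.
exact.
Qed.

(** Evaluations are continuous, so at two given points an element of the closure is within [e / 2]
    of some [ndist x0 p]. *)
Lemma lip1_hspace (h : hspace x0) : lip1 (hspace_fun h).
Proof.
have : Phi_closure x0 (set_val h) by apply: set_mem; exact: valP h.
rewrite /hspace_fun; move: (set_val h) => f cf x y.
apply/ler_addgt0Pr => e e0; have e2 : 0 < e / 2 by rewrite divr_gt0.
have near z : nbhs f [set g : cfun X | `|cfun_fun f z - cfun_fun g z| < e / 2].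
  by have /cvgrPdist_lt/(_ _ e2) := @cfun_eval_continuous z f.
have [_ [[p _ <-] [/= px py]]] := cf _ (filterI (near x) (near y)).
have {px} : `|cfun_fun f x - ndist x0 p x| < e / 2 by exact: px.
have {py} : `|cfun_fun f y - ndist x0 p y| < e / 2 by exact: py.
have := lip1_ndist x0 p x y.
move: (cfun_fun f x) (cfun_fun f y) (ndist x0 p x) (ndist x0 p y) => a b c d cd bd ac.
have -> : a - b = (a - c) + (c - d) - (b - d) by ring.
apply: (le_trans (ler_normB _ _)); rewrite (splitr e).
rewrite [leRHS]addrA lerD ?(ltW bd)//.
by rewrite (le_trans (ler_normD _ _))// addrC lerD// ltW.
Qed.

(** Each [ndist] is [lip1], which upgrades pointwise convergence to convergence on compact sets and
    makes the limit continuous; the limit then lies in the closure defining [hspace]. *)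
Lemma hspace_limit (p : nat -> X) (l : X -> R) :
  (forall z, (fun n => ndist x0 (p n) z) @ \oo --> l z) ->
  {family compact, (fun n => ndist x0 (p n)) @ \oo --> l} /\
  exists h : hspace x0, hspace_fun h = l.
Proof.
move=> pl.
have fam : {family compact, (fun n => ndist x0 (p n)) @ \oo --> l}.
  apply: lip1_family_cvg; last exact: pl.
  by exists 0%N => // n _ /=; exact: lip1_ndist.
split => //.
have ll : lip1 l.
  move=> x y; have : (fun n => `|ndist x0 (p n) x - ndist x0 (p n) y|) @ \oo -->
      `|l x - l y|.
    by apply: cvg_norm; exact: cvgB.
  move=> /cvgr_to_le; apply; near=> n; apply: (lip1_ndist x0 (p n)).
pose f : cfun X := mkcts (lip1_continuous ll).
have cf : Phi_closure x0 f.
  have cvf : (fun n => Phi x0 (p n)) @ \oo --> f by apply: cfun_cvg; exact: fam.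
  move=> B /cvf [N _ NB]; exists (Phi x0 (p N)); split; first by exists (p N).
  exact: NB (leqnn N).
by exists (exist _ f (mem_set cf)).
Unshelve. all: by end_near. Qed.

End hspace.

Section hspace_borel.
Context {R : realType} {X : metricType R} (x0 : X) (z : nat -> X).
Hypothesis z_dense : dense_seq z.

Lemma lip1_cvg_dense (f : nat -> X -> R) (l : X -> R) :
  (forall n, lip1 (f n)) -> lip1 l ->
  (forall j, (fun n => f n (z j)) @ \oo --> l (z j)) ->
  forall x, (fun n => f n x) @ \oo --> l x.
Proof.
move=> lf ll fz x; apply/cvgrPdist_le => e e0.
have e3 : 0 < e / 3 by rewrite divr_gt0.
have [j zjx] := z_dense x e3.
have /cvgrPdist_lt/(_ _ e3) near_j := fz j.
near=> n; have fnj : `|l (z j) - f n (z j)| < e / 3 by near: n.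
have := lf n (z j) x; have := ll (z j) x; move: fnj zjx.
move: (l x) (l (z j)) (f n x) (f n (z j)) (mdist _ _) => a b c d m.
rewrite !ltr_norml !ler_norml => /andP[? ?] ? /andP[? ?] /andP[? ?].
by apply/andP; split; lra.
Unshelve. all: by end_near. Qed.

(** Otherwise some [hs k] outside [U] would agree with [h] up to [k.+1%:R^-1] at the first points of
    [z]. By density and the Lipschitz bound [hs] would converge to [h], against the openness of
    [U]. *)
Lemma hspace_open_cylinder (U : set (hspace x0)) (h : hspace x0) :
  open U -> U h -> exists k : nat, forall h' : hspace x0,
    (forall j, (j <= k)%N ->
      `|hspace_fun h (z j) - hspace_fun h' (z j)| < k.+1%:R^-1) -> U h'.
Proof.
move=> [V oV VU] Uh; apply: contrapT => /forallNP nk.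
have /choice[hs hsP] : forall k : nat, exists h' : hspace x0, ~ U h' /\
    (forall j, (j <= k)%N ->
      `|hspace_fun h (z j) - hspace_fun h' (z j)| < k.+1%:R^-1).
  move=> k; have /existsNP[h' hh'] := nk k.
  by exists h'; split=> [Uh'|]; [exact: hh'|apply: contrapT => nj; apply: hh'].
have cvs : (fun n => set_val (hs n) : cfun X) @ \oo --> (set_val h : cfun X).
  apply: cfun_cvg; apply: lip1_family_cvg.
    by exists 0%N => // n _ /=; exact: lip1_hspace.
  apply: lip1_cvg_dense => [n||j]; [exact: lip1_hspace|exact: lip1_hspace|].
  apply/cvgrPdist_lt => e e0; near=> n.
  have jn : (j <= n)%N by near: n; exact: nbhs_infty_ge.
  apply: (lt_trans ((hsP n).2 j jn)).
  by near: n; exact: (near_infty_natSinv_lt (PosNum e0)).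
have Vh : nbhs (set_val h : cfun X) V.
  by apply: open_nbhs_nbhs; split => //; move: Uh; rewrite -VU.
have [N _ NV] := cvs _ Vh.
by apply: (hsP N).1; rewrite -VU; exact: NV (leqnn N).
Unshelve. all: by end_near. Qed.

(** An open set is the union of the rational cylinders [cyl] it contains; there are countably many,
    each with measurable preimage. *)
Lemma measurable_hspace d (T : measurableType d) (D : set T)
    (h : T -> hspace x0) : measurable D ->
  (forall j, measurable_fun D (fun w => hspace_fun (h w) (z j))) ->
  measurable_fun D (h : T -> borel (hspace x0)).
Proof.
move=> mD mh.
apply: (@measurability _ _ T (borel (hspace x0)) D h (@open (hspace x0))) => //.
move=> _ [U oU <-].
pose cyl (b : seq rat * nat) := [set f : X -> R | forall j, (j < size b.1)%N ->
  `|ratr b.1`_j - f (z j)| < b.2.+1%:R^-1].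
pose J := [set b | forall h' : hspace x0, cyl b (hspace_fun h') -> U h'].
rewrite (_ : D `&` h @^-1` U =
    \bigcup_b (if b \in J then D `&` [set w | cyl b (hspace_fun (h w))] else set0)).
  apply: countable_bigcupT_measurable; first exact: countableP.
  move=> b; case: ifP => // _.
  rewrite (_ : _ `&` _ = D `&` \bigcap_(j in [set j | (j < size b.1)%N])
      (D `&` [set w | `|ratr b.1`_j - hspace_fun (h w) (z j)| < b.2.+1%:R^-1])); last first.
    apply/seteqP; split=> w [Dw cw]; split => // j jb; last by have [] := cw j jb.
    by split => //; exact: cw.
  apply: measurableI => //; apply: bigcap_measurableType => j _.
  have mb : measurable_fun D
      (fun w => `|ratr b.1`_j - hspace_fun (h w) (z j)| < b.2.+1%:R^-1).
    apply: measurable_fun_ltr => //; apply: measurableT_comp => //.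
    exact: measurable_funB.
  exact: (mb mD [set true] I).
apply/seteqP; split=> w.
  move=> [Dw Uw]; have [k kP] := hspace_open_cylinder oU Uw.
  (* [(k.+1 + k).+1] is twice [k.+1], so two errors of this size add up to [k.+1%:R^-1]. *)
  have e0 : 0 < (k.+1 + k).+1%:R^-1 :> R by rewrite invr_gt0.
  have /choice[q qP] : forall j : nat, exists q : rat,
      `|ratr q - hspace_fun (h w) (z j)| < (k.+1 + k).+1%:R^-1.
    move=> j; have lt : hspace_fun (h w) (z j) <
        hspace_fun (h w) (z j) + (k.+1 + k).+1%:R^-1.
      by rewrite ltrDl.
    have [q] := rat_in_itvoo lt; rewrite in_itv /= => /andP[q1 q2].
    by exists q; rewrite ger0_norm ?subr_ge0 ?ltW// ltrBlDl.
  have [s [ss sn]] : exists s : seq rat, size s = k.+1 /\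
      forall j, (j < k.+1)%N -> s`_j = q j.
    exists (mkseq q k.+1); split; first by rewrite size_mkseq.
    by move=> j jk; rewrite nth_mkseq.
  exists (s, (k.+1 + k)%N) => //.
  rewrite ifT; last first.
    apply/mem_set => h' ch'; apply: kP => j jk.
    have := ch' j; rewrite /= ss ltnS sn ?ltnS// => /(_ jk) qh'; have := qP j.
    rewrite distrC => hq.
    have eE : (k.+1 + k).+1%:R^-1 + (k.+1 + k).+1%:R^-1 = k.+1%:R^-1 :> R.
      by rewrite -addnS addnn -muln2 natrM invfM -splitr.
    rewrite -eE (le_lt_trans _ (ltrD hq qh'))//.
    by rewrite (le_trans _ (ler_normD _ _))// addrA subrK.
  split => // j; rewrite /= ss => jk; rewrite sn//; exact: qP.
by move=> [b _]; case: ifPn => // /set_mem Jb [Dw cw]; split => //; exact: Jb.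
Qed.

End hspace_borel.

(** * Measurable extraction of a limit *)

Section refinement.
Context d (T : measurableType d).
Implicit Types (G : (set T)^nat) (E : nat -> (set T)^nat).

(* Keeps the times [n] of [G] whose label is the least label occurring
   infinitely often along [G]; [E c n w] reads "time [n] has label [c]". *)
Definition refine G E : (set T)^nat := fun n => G n `&`
  \bigcup_c (seqDU (fun c => lim_sup_set (fun n => G n `&` E c n)) c `&` E c n).

Lemma measurable_refine G E : (forall n, measurable (G n)) ->
  (forall c n, measurable (E c n)) -> forall n, measurable (refine G E n).
Proof.
move=> mG mE n.
have mS c : measurable (lim_sup_set (fun n => G n `&` E c n)).
  by apply: measurable_lim_sup_set => k; exact: measurableI.
apply: measurableI => //; apply: bigcupT_measurable => c.
apply: measurableI => //; apply: measurableD => //.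
exact: bigsetU_measurable.
Qed.

Lemma refine_label G E w n n' : refine G E n w -> refine G E n' w ->
  exists c, E c n w /\ E c n' w.
Proof.
move=> [_ [c _ [Sc En]]] [_ [c' _ [Sc' En']]].
have cc' := @trivIset_seqDU _ _ _ _ I I (ex_intro _ w (conj Sc Sc')).
by exists c; split => //; rewrite cc'.
Qed.

(** By pigeonhole one of the [C] labels recurs infinitely often along [G]; the least recurring one
    is the label kept by [refine]. *)
Lemma lim_sup_refine G E C w : lim_sup_set G w ->
  (forall n, exists2 c, (c < C)%N & E c n w) -> lim_sup_set (refine G E) w.
Proof.
move=> /lim_sup_setP Gw Ew.
pose S c := lim_sup_set (fun n => G n `&` E c n).
have [c Sc] : exists c, S c w.
  apply: contrapT => /forallNP nS.
  have /choice[N NP] : forall c, exists N, forall n, (N <= n)%N ->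
      ~ (G n w /\ E c n w).
    move=> c; apply: contrapT => /forallNP h; apply: (nS c).
    apply/lim_sup_setP => M; have /existsNP[n /not_implyP[Mn /contrapT ?]] := h M.
    by exists n.
  have [n nN Gn] := Gw (\max_(c < C) N c)%N.
  have [c cC En] := Ew n.
  apply: (NP c n) => //; apply: leq_trans nN.
  exact: (leq_bigmax (Ordinal cC)).
have : (\bigcup_c seqDU S c) w by rewrite -seqDU_bigcup_eq; exists c.
move=> [c' _ Sc'] ; have /lim_sup_setP Sc'w : S c' w by case: Sc'.
apply/lim_sup_setP => N; have [n Nn [Gn En]] := Sc'w N.
by exists n => //; split => //; exists c'.
Qed.

Fixpoint iter_refine G (E : nat -> nat -> (set T)^nat) k : (set T)^nat :=
  if k is k'.+1 then refine (iter_refine G E k') (E k') else G.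

Lemma sub_iter_refine G (E : nat -> nat -> (set T)^nat) i k : (k <= i)%N ->
  forall n, iter_refine G E i n `<=` iter_refine G E k n.
Proof.
move=> /subnK <-; elim: (i - k)%N => [|j IH] n w; first by rewrite add0n.
by rewrite addSn => -[h _]; exact: IH.
Qed.

(** [seqDU Q n w] singles out the least [n] with [Q n w]; the value is 0 if there is none. *)
Definition first_hit (Q : (set T)^nat) w : nat := xget 0%N [set n | seqDU Q n w].

Lemma first_hitP Q w n : seqDU Q n w -> first_hit Q w = n.
Proof.
move=> Qn; have Qf : seqDU Q (first_hit Q w) w.
  by apply: (@xgetPex _ 0%N [set n | seqDU Q n w]); exists n.
exact: @trivIset_seqDU _ _ _ _ I I (ex_intro _ w (conj Qf Qn)).
Qed.

Lemma first_hit_mem Q w : (\bigcup_n Q n) w -> Q (first_hit Q w) w.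
Proof.
by rewrite seqDU_bigcup_eq => -[n _ Qn]; rewrite (first_hitP Qn); case: Qn.
Qed.

Lemma measurable_first_hit d' (U : measurableType d') (Q : (set T)^nat) (D : set T)
    (f : nat -> T -> U) : measurable D -> (forall n, measurable (Q n)) ->
  D `<=` \bigcup_n Q n -> (forall n, measurable_fun setT (f n)) ->
  measurable_fun D (fun w => f (first_hit Q w) w).
Proof.
move=> mD mQ DQ mf _ B mB.
rewrite (_ : _ `&` _ = D `&` \bigcup_n (seqDU Q n `&` f n @^-1` B)).
  apply: measurableI => //; apply: bigcupT_measurable => n; apply: measurableI.
    by apply: measurableD => //; exact: bigsetU_measurable.
  by have := mf n measurableT B mB; rewrite setTI.
apply/seteqP; split=> w [Dw]; rewrite /preimage /=.
  move=> fB; split => //; have := DQ w Dw; rewrite seqDU_bigcup_eq => -[n _ Qn].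
  by exists n => //; split => //=; rewrite -(first_hitP Qn).
by move=> [n _ [Qn /= fB]]; split => //; rewrite (first_hitP Qn).
Qed.

End refinement.

Section limit_selection.
Context {R : realType} {X : metricType R} (x0 : X) (z : nat -> X).
Hypothesis z_dense : dense_seq z.

(** Quantizes the value at [z j] with mesh [m.+1%:R^-1], where [jm] is [(j, m)]. The added distance
    makes the argument nonnegative, so that truncation is the integer part. *)
Let label (jm : nat * nat) (x : X) : nat :=
  Num.trunc (jm.2.+1%:R * (ndist x0 x (z jm.1) + mdist x0 (z jm.1))).

Let label_ge0 jm x : 0 <= jm.2.+1%:R * (ndist x0 x (z jm.1) + mdist x0 (z jm.1)).
Proof.
rewrite mulr_ge0// -lerBlDr sub0r.
by have := norm_ndist x0 x (z jm.1); rewrite ler_norml => /andP[].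
Qed.

Let label_lt jm x : (label jm x <
  (Num.trunc (jm.2.+1%:R * (mdist x0 (z jm.1) + mdist x0 (z jm.1)))).+1)%N.
Proof.
rewrite ltnS; apply: le_truncn; rewrite ler_wpM2l// lerD2r.
by have := norm_ndist x0 x (z jm.1); rewrite ler_norml => /andP[].
Qed.

Let label_close j m x y : label (j, m) x = label (j, m) y ->
  `|ndist x0 x (z j) - ndist x0 y (z j)| < m.+1%:R^-1.
Proof.
rewrite /label /= => xy.
have /andP[] := truncn_itv (label_ge0 (j, m) x).
have /andP[] := truncn_itv (label_ge0 (j, m) y).
rewrite /= xy -!natr1; move: (Num.trunc _)%:R => t.
have m0 : 0 < m%:R + 1 :> R by rewrite natr1 ltr0n.
move: (ndist _ _ _) (ndist _ _ _) (mdist _ _) m0 => a b c; move: (m%:R + 1) => M M0.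
move=> b1 b2 a1 a2.
rewrite -(ltr_pM2l M0) divff ?gt_eqF// -{1}(gtr0_norm M0) -normrM ltr_norml.
by apply/andP; split; lra.
Qed.

Lemma lip1_is_cvg_dense (f : nat -> X -> R) : (forall n, lip1 (f n)) ->
  (forall j, cvg (f n (z j) @[n --> \oo])) -> forall x, cvg (f n x @[n --> \oo]).
Proof.
move=> lf fz x; apply: cauchy_cvg; apply: cauchy_exP => e e0.
have e3 : 0 < e / 3 by rewrite divr_gt0.
have [j zjx] := z_dense x e3.
exists (lim (f n (z j) @[n --> \oo])).
have /cvgrPdist_lt/(_ _ e3) near_j := fz j.
suff : \forall n \near \oo, ball (lim (f n (z j) @[n --> \oo])) e (f n x) by exact.
near=> n; have fnj : `|lim (f n (z j) @[n --> \oo]) - f n (z j)| < e / 3 by near: n.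
rewrite -ball_normE /=; have := lf n (z j) x; move: fnj zjx.
move: (lim _) (f n x) (f n (z j)) (mdist _ _) => a b c m.
rewrite !ltr_norml !ler_norml => /andP[? ?] ? /andP[? ?].
by apply/andP; split; lra.
Unshelve. all: by end_near. Qed.

(** Times in the [k]-th refinement share the labels of the first [k] pairs. Taking there the first
    time that is at least [k] makes the values at each [z j] Cauchy, and the Lipschitz bound extends
    the limit to all of [X]. *)
Lemma measurable_limit_selection d (T : measurableType d) (D : set T)
    (p : nat -> T -> X) (G : (set T)^nat) : measurable D ->
  (forall n y, measurable_fun setT (fun w => mdist (p n w) y)) ->
  (forall n, measurable (G n)) -> D `<=` lim_sup_set G ->
  exists h : T -> hspace x0, measurable_fun D (h : T -> borel (hspace x0)) /\
    forall w, D w -> exists q : nat -> nat,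
      (forall i, (i <= q i)%N /\ G (q i) w) /\
      {family compact, (fun i => ndist x0 (p (q i) w)) @ \oo --> hspace_fun (h w)}.
Proof.
move=> mD mp mG DG.
have mnd n j : measurable_fun setT (fun w => ndist x0 (p n w) (z j)).
  by rewrite /ndist; apply: measurable_funB.
pose jm k : nat * nat := odflt (0%N, 0%N) (unpickle k).
pose E k c n := [set w | label (jm k) (p n w) = c].
have mE k c n : measurable (E k c n).
  have -> : E k c n = [set w | c%:R <= (jm k).2.+1%:R *
      (ndist x0 (p n w) (z (jm k).1) + mdist x0 (z (jm k).1))] `&`
      [set w | (jm k).2.+1%:R *
      (ndist x0 (p n w) (z (jm k).1) + mdist x0 (z (jm k).1)) < c.+1%:R].
    apply/seteqP; split=> w; rewrite /E /label /=.
      by move=> <-; have /andP[] := truncn_itv (label_ge0 (jm k) (p n w)).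
    by move=> [h1 h2]; apply/eqP; rewrite truncn_eq ?h1 ?h2// label_ge0.
  have mu : measurable_fun setT (fun w => (jm k).2.+1%:R *
      (ndist x0 (p n w) (z (jm k).1) + mdist x0 (z (jm k).1))).
    by apply: measurable_funM => //; apply: measurable_funD.
  apply: measurableI; apply: measurable_bool.
    by apply: measurable_fun_ler.
  by apply: measurable_fun_ltr.
pose H := iter_refine G E.
have mH k n : measurable (H k n).
  by elim: k n => // k IH n; apply: measurable_refine.
have DH k : D `<=` lim_sup_set (H k).
  elim: k => // k IH w Dw.
  apply: (lim_sup_refine (IH w Dw)) => n.
  by exists (label (jm k) (p n w)); [exact: label_lt|].
(* The restriction [i <= n] gives [i <= q i w], so the diagonal times tend to infinity. *)
pose Q i n := if (i <= n)%N then H i n else set0.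
have mQ i n : measurable (Q i n) by rewrite /Q; case: ifP.
have DQ i : D `<=` \bigcup_n Q i n.
  move=> w /(DH i)/lim_sup_setP/(_ i)[n ni Hn]; exists n => //.
  by rewrite /Q ni.
pose q i w := first_hit (Q i) w.
have qP i w : D w -> (i <= q i w)%N /\ H i (q i w) w.
  move=> /(DQ i)/first_hit_mem; rewrite -/(q i w) /Q.
  by case: ifP.
pose f i w := ndist x0 (p (q i w) w).
have fz w j : D w -> cvg (f i w (z j) @[i --> \oo]).
  move=> Dw; apply: cauchy_cvg; apply: cauchy_exP => e e0.
  have [m me] := filter_ex (near_infty_natSinv_lt (PosNum e0)).
  (* Once [i > k], the times [q i w] and [q k.+1 w] both lie in [H k.+1], hence have the same label
     for [(j, m)]. *)
  pose k := pickle (j, m); exists (f k.+1 w (z j)).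
  suff : \forall i \near \oo, ball (f k.+1 w (z j)) e (f i w (z j)) by exact.
  near=> i; rewrite -ball_normE /=; apply: (lt_trans _ me).
  have ki : (k < i)%N by near: i; exact: nbhs_infty_gt.
  have Hi := sub_iter_refine ki (qP i w Dw).2.
  have [c [<-]] := refine_label Hi (qP k.+1 w Dw).2.
  by rewrite /E /jm /= pickleK /= => /label_close.
have fx w x : D w -> cvg (f i w x @[i --> \oo]).
  move=> Dw; apply: (@lip1_is_cvg_dense (fun i => f i w)) => [n|j].
    exact: lip1_ndist.
  exact: fz.
(* On [D] the values of the chosen [h] are limits of measurable functions, so the choice does not
   spoil measurability. *)
have /choice[h hP] : forall w, exists h : hspace x0, D w ->
    {family compact, (fun i => f i w) @ \oo --> hspace_fun h}.
  move=> w; have [Dw|nDw] := pselect (D w); last by exists point.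
  have [fam [h hE]] := @hspace_limit R X x0 (fun i => p (q i w) w)
    (fun x => lim (f i w x @[i --> \oo])) (fun x => fx w x Dw).
  by exists h => _; rewrite hE.
have hz w x : D w -> f i w x @[i --> \oo] --> hspace_fun (h w) x.
  move=> /hP fam.
  have [/(_ (pointwise_cvg_compact_family _ fam) x)] :=
    @pointwise_cvgP X R ((fun i => f i w) @ \oo) (hspace_fun (h w)) _.
  exact.
exists h; split.
  apply: (measurable_hspace z_dense mD) => j.
  apply: (@measurable_fun_cvg _ _ R D (fun i w => f i w (z j))).
    move=> i; apply: (measurable_first_hit
      (f := fun n w => ndist x0 (p n w) (z j))) => //; exact: DQ.
  by move=> w Dw; exact: hz.
move=> w Dw; exists (q ^~ w); split; last exact: hP.
move=> i; have [iq Hi] := qP i w Dw; split => //.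
exact: (sub_iter_refine (leq0n i) Hi).
Unshelve. all: by end_near. Qed.

End limit_selection.

(** * Cocycles of isometries *)

Lemma lip1_mdist {R : realType} {X : metricType R} (z : X) : lip1 (mdist^~ z).
Proof.
move=> a b; have := metric_triangle a b z; have := metric_triangle b a z.
by rewrite (metric_sym b a) ler_norml => ? ?; apply/andP; split; lra.
Qed.

Section horofunction_selection.
Context {R : realType} {X : metricType R} (x0 : X).

(** A compact set lies in finitely many unit balls, hence in one ball about [x0]; the sum of the
    distances to the centres stands in for their maximum. *)
Lemma far_to_infinity (x : nat -> X) :
  (forall r : R, \forall n \near \oo, r < mdist x0 (x n)) -> to_infinity x.
Proof.
move=> xr K /(compact_net (ltr01 : 0 < 1 :> R))[s sP].
apply: filterS (xr (\sum_(y <- s) mdist x0 y + 1)) => n /= + Kx.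
have [y ys yx] := sP _ Kx; apply/negP; rewrite -leNgt.
apply: (le_trans (metric_triangle x0 y _)); rewrite lerD ?(ltW yx)//.
by rewrite (big_rem y)//= lerDl sumr_ge0// => i _; exact: mdist_ge0.
Qed.

Lemma noncompact_far : proper_space X -> ~ compact [set: X] ->
  exists x : nat -> X, forall n : nat, n%:R < mdist x0 (x n).
Proof.
move=> pX ncX.
suff /choice[x xP] : forall n : nat, exists x, n%:R < mdist x0 x by exists x.
move=> n; apply: contrapT => /forallNP nx; apply: ncX; apply: pX; first exact: closedT.
have le x : mdist x0 x <= n%:R by rewrite leNgt; apply/negP.
exists (n%:R + n%:R) => x y _ _; rewrite (le_trans (metric_triangle x x0 y))//.
by rewrite lerD// metric_sym.
Qed.

(** [norm_ndist] passes to the closure; this supplies the upper bound on [- h] along the orbit. *)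
Lemma norm_hspace_fun (h : hspace x0) x : `|hspace_fun h x| <= mdist x0 x.
Proof.
have : Phi_closure x0 (set_val h) by apply: set_mem; exact: valP h.
rewrite /hspace_fun; move: (set_val h) => f cf; apply/ler_addgt0Pr => e e0.
have near_x : nbhs f [set k : cfun X | `|cfun_fun f x - cfun_fun k x| < e].
  by have /cvgrPdist_lt/(_ _ e0) := @cfun_eval_continuous R X x f.
have [_ [[p _ <-] /= px]] := cf _ near_x.
rewrite -(subrK (ndist x0 p x) (cfun_fun f x)) addrC.
by rewrite (le_trans (ler_normD _ _))// lerD ?norm_ndist// ltW.
Qed.

End horofunction_selection.

Section cocycle.
Context {R : realType} {X : metricType R} (x0 : X).
Context d (T : measurableType d) (L : T -> T) (g : T -> isom X).

Lemma cocycle0 w x : cocycle L g 0 w x = x.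
Proof. by rewrite /cocycle big_geq. Qed.

Lemma cocycle1 w : cocycle L g 1 w = g w.
Proof. by rewrite /cocycle big_nat1. Qed.

Lemma cocycleD n m w x :
  cocycle L g (n + m) w x = cocycle L g n w (cocycle L g m (iter n L w) x).
Proof.
rewrite /cocycle (@big_cat_nat _ _ _ n)//= ?leq_addr//.
rewrite -{2}(add0n n) big_addn addKn.
have -> : (\prod_(0 <= i < m) g (iter (i + n) L w) =
    \prod_(0 <= i < m) g (iter i L (iter n L w)))%g.
  by apply: eq_bigr => i _; rewrite iterD.
by [].
Qed.

(** Left invariance turns the inequality of good times into a bound on
    [ndist x0 (Z_n x0) (Z_l x0)]. *)
Lemma mdist_cocycle n l w : (l <= n)%N ->
  mdist (cocycle L g n w x0) (cocycle L g l w x0) =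
  mdist (cocycle L g (n - l) (iter l L w) x0) x0.
Proof. by move=> ln; rewrite -{1}(subnKC ln) cocycleD isom_dist. Qed.

Lemma mdist_cocycle_subadditive n m w :
  mdist (cocycle L g (n + m) w x0) x0 <=
  mdist (cocycle L g n w x0) x0 + mdist (cocycle L g m (iter n L w) x0) x0.
Proof.
rewrite cocycleD addrC (le_trans (metric_triangle _ (cocycle L g n w x0) _))//.
by rewrite isom_dist.
Qed.

Lemma borel_continuous_measurable (Y : ptopologicalType) (f : Y -> R) :
  continuous f -> measurable_fun setT (f : borel Y -> R).
Proof.
move=> cf; apply: (measurability _ (RGenOpens.measurableE R)).
move=> _ [_ [x [y ->]] <-]; rewrite setTI; apply: sub_sigma_algebra.
by apply: open_comp => [? _|]; [exact: cf|exact: interval_open].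
Qed.

Lemma isom_eval_continuous (y z : X) : continuous (fun f : isom X => mdist (f y) z).
Proof.
move=> f.
have fam : {family compact, (@isom_fun R X) @ nbhs f --> isom_fun f}.
  exact: (@initial_continuous _ {family compact, X -> X} (@isom_fun R X) f).
have [/(_ (pointwise_cvg_compact_family _ fam) y) fy _] :=
  @pointwise_cvgP X X ((@isom_fun R X) @ nbhs f) (isom_fun f) _.
have mz : continuous (fun t : X => mdist t z).
  by apply: lip1_continuous; exact: lip1_mdist.
exact: cvg_comp fy (mz (f y)).
Qed.

Hypothesis g_measurable : measurable_fun [set: T] (g : T -> borel (isom X)).
Hypothesis L_measurable : measurable_fun [set: T] L.
Variable z : nat -> X.
Hypothesis z_dense : dense_seq z.

(** Measurability of a map into [X] is expressed by distances to points. Replace [P w] by the first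
    point of [z] within [k.+1%:R^-1] of it, a choice with countably many values; [g w] is an
    isometry, so the error stays as small, and [k] tends to infinity. *)
Lemma measurable_isom_apply (P : T -> X) :
  (forall y, measurable_fun setT (fun w => mdist (P w) y)) ->
  forall y, measurable_fun setT (fun w => mdist (g w (P w)) y).
Proof.
move=> mP y.
pose Q (k : nat) j := [set w | mdist (P w) (z j) < k.+1%:R^-1].
have mQ k j : measurable (Q k j).
  by apply: measurable_bool; apply: measurable_fun_ltr.
have TQ k : setT `<=` \bigcup_j Q k j.
  move=> w _; have [|j jP] := z_dense (P w) (_ : 0 < k.+1%:R^-1 :> R).
    by rewrite invr_gt0.
  by exists j => //; rewrite /Q /= metric_sym.
have mgz j : measurable_fun setT (fun w => mdist (g w (z j)) y).
  have := borel_continuous_measurable (@isom_eval_continuous (z j) y).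
  by move=> /measurableT_comp; apply.
pose f k w := mdist (g w (z (first_hit (Q k) w))) y.
apply: (@measurable_fun_cvg _ _ R setT f) => [k|w _].
  by apply: (measurable_first_hit (f := fun j w => mdist (g w (z j)) y)) => //; exact: TQ.
apply/cvgrPdist_lt => e e0; near=> k.
apply: (@le_lt_trans _ _ (mdist (P w) (z (first_hit (Q k) w)))).
  by rewrite -[leRHS](isom_dist (g w)); exact: lip1_mdist.
have : Q k (first_hit (Q k) w) w by apply: first_hit_mem; exact: TQ.
move=> /lt_trans; apply; near: k; exact: (near_infty_natSinv_lt (PosNum e0)).
Unshelve. all: by end_near. Qed.

Lemma measurable_cocycle n y :
  measurable_fun setT (fun w => mdist (cocycle L g n w x0) y).
Proof.
elim: n y => [|n IH] y.
  by under eq_fun do rewrite cocycle0; exact: measurable_cst.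
under eq_fun do rewrite -add1n cocycleD cocycle1.
apply: measurable_isom_apply => y'.
exact: (measurableT_comp (IH y') L_measurable).
Qed.

End cocycle.

(** Used with the orbit as [p] when [A > 0], and with a fixed sequence when [A = 0]. Upper bounds
    holding eventually along the times of [G] pass to the limit. *)
Lemma horofunction_of_times (R : realType) (X : metricType R) (x0 : X)
    (X_proper : proper_space X) d (T : measurableType d) (D : set T)
    (p : nat -> T -> X) (G : (set T)^nat) : measurable D ->
  (forall n y, measurable_fun setT (fun w => mdist (p n w) y)) ->
  (forall n, measurable (G n)) -> D `<=` lim_sup_set G ->
  (forall w, D w -> forall r : R, \forall n \near \oo, r < mdist x0 (p n w)) ->
  exists h : T -> hspace x0, measurable_fun D (h : T -> borel (hspace x0)) /\
    forall w, D w -> horofunction x0 (hspace_fun (h w)) /\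
      forall (y : X) (c : R),
        (\forall n \near \oo, G n w -> ndist x0 (p n w) y <= c) ->
        hspace_fun (h w) y <= c.
Proof.
move=> mD mp mG DG far.
have [z zd] := proper_dense_seq x0 X_proper.
have [h [mh hP]] := measurable_limit_selection x0 zd mD mp mG DG.
exists h; split => // w Dw; have [q [qG fam]] := hP w Dw.
have q_oo (P : nat -> Prop) : (\forall n \near \oo, P n) -> \forall i \near \oo, P (q i).
  move=> [N _ NP]; exists N => // i /= Ni; apply: NP => /=.
  by apply: leq_trans Ni _; case: (qG i).
split.
  exists (fun i => p (q i) w); split => //.
  by apply: far_to_infinity => r; exact: (q_oo _ (far w Dw r)).
move=> y c cP.
have [/(_ (pointwise_cvg_compact_family _ fam) y) hy _] :=
  @pointwise_cvgP X R ((fun i => ndist x0 (p (q i) w)) @ \oo) (hspace_fun (h w)) _.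
apply: (cvgr_to_le hy); move: (q_oo _ cP); apply: filterS => i; apply.
by case: (qG i).
Qed.

(* If X is compact there are no horofunctions at all, hence [X_noncompact]. *)
Theorem theorem1p1 (R : realType) (X : metricType R) (x0 : X)
  (X_proper : proper_space X)
  (X_noncompact : ~ compact [set: X])
  (d : measure_display) (Omega : measurableType d) (mu : probability Omega R)
  (Omega_borel : standard_borel R Omega)
  (L : Omega -> Omega)
  (L_preserving : measure_preserving mu L)
  (L_ergodic : ergodic mu L)
  (g : Omega -> isom X)
  (g_measurable : measurable_fun [set: Omega] (g : Omega -> borel (isom X)))
  (g_integrable : (\int[mu]_(w in [set: Omega]) (mdist (g w x0) x0)%:E < +oo)%E)
  (A : R)
  (A_drift : {ae mu, forall w,
     (fun n : nat => n%:R^-1 * mdist (cocycle L g n w x0) x0) @ \oo --> A}) :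
  exists (D : set Omega) (h : Omega -> hspace x0),
    [/\ measurable D, mu D = 1%E,
        measurable_fun D (h : Omega -> borel (hspace x0)) &
        forall w, D w ->
          horofunction x0 (hspace_fun (h w)) /\
          (fun n : nat =>
             - (n%:R^-1 * hspace_fun (h w) (cocycle L g n w x0))) @ \oo --> A].
Proof.
have [mL _] := L_preserving.
pose a n w := mdist (cocycle L g n w x0) x0.
have ma n : nnmfun (a n).
  split=> [|w]; last exact: mdist_ge0.
  have [z zd] := proper_dense_seq x0 X_proper.
  exact: (measurable_cocycle x0 g_measurable mL zd).
have a00 w : a 0%N w = 0 by rewrite /a cocycle0 mdistxx.
have aD n m w : a (n + m)%N w <= a n w + a m (iter n L w).
  exact: mdist_cocycle_subadditive.
have a1_int : (nnint mu (a 1%N) < +oo)%E.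
  by rewrite /nnint /a; under eq_integral do rewrite cocycle1.
(* A set of full measure is nonempty, and one convergent trajectory suffices for [0 <= A]. *)
have [w0 drift0] : exists w, n%:R^-1 * a n w @[n --> \oo] --> A.
  have ae_proper : ProperFilter (almost_everywhere mu).
    apply: ae_properfilter_algebraOfSetsType.
    by rewrite [ltRHS](_ : _ = 1%E) ?lte01//; exact: probability_setT.
  exact: filter_ex A_drift.
have A0 : 0 <= A.
  apply: (cvgr_to_ge drift0); apply: nearW => n.
  by rewrite mulr_ge0// ?invr_ge0//; exact: mdist_ge0.
have [D1 [G [mD1 D11 mG DG Ggood]]] :=
  good_times L_preserving ma a00 aD a1_int A0 A_drift.
have [N [mN N0 NP]] := A_drift.
pose D := D1 `\` N.
have mD : measurable D by exact: measurableD.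
have D_full : mu D = 1%E.
  have : (mu D1 = mu (D1 `\` N) + mu (D1 `&` N))%E by exact: measureDI.
  have -> : mu (D1 `&` N) = 0%E.
    by apply: (subset_measure0 _ mN) => //; exact: measurableI.
  by rewrite adde0 D11 => <-.
have drift w : D w -> n%:R^-1 * a n w @[n --> \oo] --> A.
  by move=> [_ Nw]; apply: contrapT => h; apply: Nw; exact: NP.
have a_near w e : D w -> 0 < e -> \forall n \near \oo, a n w <= (A + e) * n%:R.
  move=> Dw e0; have /cvgrPdist_le/(_ _ e0) aA := drift w Dw.
  near=> n; have n0 : 0 < n%:R :> R by rewrite ltr0n; near: n; exact: nbhs_infty_gt.
  rewrite -ler_pdivrMr// mulrC -lerBlDl.
  by rewrite (le_trans (ler_norm _))// distrC; near: n.
(* Only the upper bound on [h] is left to find: the lower one follows from [norm_hspace_fun] and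
   [a_near]. *)
suff [h [mh hP]] : exists h : Omega -> hspace x0,
    measurable_fun D (h : Omega -> borel (hspace x0)) /\
    forall w, D w -> horofunction x0 (hspace_fun (h w)) /\
      forall e : R, 0 < e -> \forall l \near \oo,
        hspace_fun (h w) (cocycle L g l w x0) <= - ((A - e) * l%:R).
  exists D, h; split => // w Dw; have [hw low] := hP w Dw; split => //.
  apply/cvgrPdist_le => e e0; near=> n.
  have n0 : 0 < n%:R :> R by rewrite ltr0n; near: n; exact: nbhs_infty_gt.
  have up_n : a n w <= (A + e) * n%:R by near: n; exact: a_near.
  have low_n : hspace_fun (h w) (cocycle L g n w x0) <= - ((A - e) * n%:R).
    by near: n; exact: low.
  have := norm_hspace_fun (h w) (cocycle L g n w x0).
  rewrite metric_sym -/(a n w) => /ler_normlP[h1 _].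
  rewrite opprK mulrC; move: low_n up_n h1; move: (hspace_fun _ _) (a n w) => y b.
  move=> y1 b1 yb.
  have t1 : y / n%:R <= - (A - e) by rewrite ler_pdivrMr// mulNr.
  have t2 : - (A + e) <= y / n%:R by rewrite ler_pdivlMr// mulNr; lra.
  by rewrite ler_norml; apply/andP; split; lra.
(* For [A = 0] the orbit need not leave compact sets, so a fixed sequence going to infinity replaces
   it; the bound comes from [norm_hspace_fun] and [a l w <= e * l]. *)
have [A_gt0|A_le0] := ltP 0 A; last first.
  have {A_le0} AE : A = 0 by apply/eqP; rewrite eq_le A_le0.
  have [x xP] := noncompact_far x0 X_proper X_noncompact.
  have [||||h [mh hP]] := @horofunction_of_times R X x0 X_proper d Omega D
      (fun n _ => x n) (fun=> setT) mD.
  - by move=> n y; exact: measurable_cst.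
  - by [].
  - by move=> w _; apply/lim_sup_setP => n; exists n.
  - move=> w _ r; near=> n; apply: le_lt_trans (xP n).
    by near: n; exact: nbhs_infty_ger.
  exists h; split => // w Dw; have [hw _] := hP w Dw; split => // e e0.
  near=> l; have : a l w <= (A + e) * l%:R by near: l; exact: a_near.
  have := norm_hspace_fun (h w) (cocycle L g l w x0).
  rewrite metric_sym -/(a l w) => /ler_normlP[_ h1].
  by rewrite AE add0r sub0r mulNr opprK; exact: le_trans h1.
have [||||h [mh hP]] := @horofunction_of_times R X x0 X_proper d Omega D
    (fun n w => cocycle L g n w x0) G mD.
- have [z zd] := proper_dense_seq x0 X_proper.
  by move=> n y; exact: (measurable_cocycle x0 g_measurable mL zd).
- exact: mG.
- by move=> w [D1w _]; exact: DG.
- move=> w Dw r.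
  have A2 : 0 < A / 2 by rewrite divr_gt0.
  have /cvgrPdist_le/(_ _ A2) aA := drift w Dw.
  near=> n; have n0 : 0 < n%:R :> R by rewrite ltr0n; near: n; exact: nbhs_infty_gt.
  have rn : r / (A / 2) < n%:R by near: n; exact: nbhs_infty_gtr.
  rewrite metric_sym -/(a n w); rewrite ltr_pdivrMr// in rn; apply: (lt_le_trans rn).
  have : `|A - n%:R^-1 * a n w| <= A / 2 by near: n.
  move=> /ler_normlP[_]; rewrite (mulrC n%:R) -ler_pdivlMr// [a n w / _]mulrC.
  by move: (_ * a n w) => y; lra.
exists h; split => // w Dw; have [hw hlow] := hP w Dw; split => // e e0.
have [K KP] := Ggood w (proj1 Dw) e e0.
(* Here [l] is fixed and [n] tends to infinity along good times, which is possible because [K] does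
   not depend on [n]. *)
exists K => // l /= Kl; apply: hlow; near=> n => Gn.
have ln : (l <= n)%N by near: n; exact: nbhs_infty_ge.
have := KP n l Gn; rewrite Kl ln => /(_ isT).
by rewrite /a -mdist_cocycle// /ndist lerNr opprB.
Unshelve. all: by end_near. Qed.
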